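(* For the pionless-EFT Hamiltonian $H=H_{\rm free}+H_C+H_D$ on an $L\times L\times L$ lattice and its first-order product formula $\mathcal P_1(t)=\prod_{\gamma=1}^{7}e^{-itH_\gamma}$ (seven-layer decomposition in the context), $$\big\|e^{-itH}-\mathcal P_1(t)\big\|_\eta\le t^2\Big(15h^2\eta+6h\Big(A_1\Big\lfloor\frac\eta2\Big\rfloor+A_2\Big\lfloor\frac\eta3\Big\rfloor+A_3\Big\lfloor\frac\eta4\Big\rfloor\Big)\Big),$$ where $A_1=2|C|$, $A_2=2|3C+D|+|D|$, $A_3=2|6C+4D|+4|D|$.
   Context: Cubic lattice $\Lambda(L)$ with $L^3$ sites, spacing $a_L$, open boundary conditions. At each site $\bm x$ there are four fermionic modes $a_\sigma(\bm x)$, $\sigma\in\{\uparrow p,\downarrow p,\uparrow n,\downarrow n\}$, with canonical anticommutation relations, $N_\sigma=a^\dagger_\sigma a_\sigma$. Let $h=\frac1{2Ma_L^2}>0$ ($M$ the nucleon mass), and let $C,D\in\mathbb R$ be the two- and three-nucleon low-energy constants. The Hamiltonian is $H=H_{\rm free}+H_C+H_D$ with $H_{\rm free}=-h\sum_{\langle\bm x,\bm y\rangle}\sum_\sigma(a^\dagger_\sigma(\bm x)a_\sigma(\bm y)+a_\sigma^\dagger(\bm y)a_\sigma(\bm x))+6h\sum_{\bm x,\sigma}N_\sigma(\bm x)$ (nearest-neighbour pairs), $H_C=\frac C2\sum_{\bm x}\sum_{\sigma\ne\sigma'}N_\sigma(\bm x)N_{\sigma'}(\bm x)$, $H_D=\frac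 D6\sum_{\bm x}\sum_{\sigma,\sigma',\sigma''\text{ pairwise distinct}}N_\sigma(\bm x)N_{\sigma'}(\bm x)N_{\sigma''}(\bm x)$ (ordered sums). Layers: the set of nearest-neighbour bonds is partitioned into six sets $\Omega_1,\dots,\Omega_6$, two for each Cartesian direction (alternating bonds along that direction), so that bonds within one $\Omega_\gamma$ share no site. For $\gamma=1,\dots,6$, $H_\gamma=-h\sum_\sigma\sum_{(i,j)\in\Omega_\gamma}(a_\sigma^\dagger(i)a_\sigma(j)+a^\dagger_\sigma(j)a_\sigma(i))+h\sum_\sigma\sum_iN_\sigma(i)$, and $H_7=H_C+H_D$. $\|X\|_\eta=\max|\langle\psi_\eta|X|\phi_\eta\rangle|$ over normalized states with exactly $\eta$ fermions. *)

(* Defs.v *)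
From mathcomp Require Import all_boot all_order all_algebra.
From mathcomp Require Import complex.
From mathcomp Require Import all_classical all_reals all_analysis.

Set Implicit Arguments.
Unset Strict Implicit.
Unset Printing Implicit Defensive.

Import Order.TTheory GRing.Theory Num.Theory numFieldNormedType.Exports.

Local Open Scope ring_scope.
Local Open Scope complex_scope.
Local Open Scope sesquilinear_scope.

Definition expmx (K : numFieldType) (n : nat) (A : 'M[K]_n) : 'M[K]_n :=
  lim (series (fun k => k`!%:R^-1 *: A ^+ k) @ \oo)%classic.

Notation site L := {ffun 'I_3 -> 'I_L}.

(* First component: spin (up / down); second: isospin (proton / neutron). *)
Notation species := (bool * bool)%type.

Notation mode L := (site L * species)%type.

(* The bond {x, x + e_d} is encoded by the single oriented pair (x, x + e_d);
   y k is an ordinal below L, so no bond wraps around the boundary. *)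
Definition step (L : nat) (d : 'I_3) (b : site L * site L) : bool :=
  [forall k, b.2 k == (b.1 k + (k == d))%N :> nat].

Definition bonds (L : nat) : {set site L * site L} :=
  [set b | [exists d, step d b]].

Definition ends (L : nat) (b : site L * site L) : {set site L} :=
  [set b.1; b.2].

(* Layers may be empty (e.g. for L <= 2).  Consecutive bonds on a lattice line
   share a site, so two site-disjoint layers per direction must alternate. *)
Definition is_layering (L : nat) (Omega : 'I_6 -> {set site L * site L}) :
    Prop :=
  [/\ \bigcup_(g < 6) Omega g = bonds L,
      forall g g', g != g' -> [disjoint Omega g & Omega g'],
      (exists2 dir : 'I_6 -> 'I_3,
         forall d, #|[set g | dir g == d]| = 2%N
         & forall g, {in Omega g, forall b, step (dir g) b}) &
      forall g, {in Omega g &, forall b b',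
         b != b' -> [disjoint ends b & ends b']}].

(* Fock space: column vectors indexed by the finite sets of occupied modes. *)
Notation fockdim L := #|{: {set mode L}}|.
Notation fock R L := 'cV[R[i]]_(fockdim L).
Notation fockop R L := 'M[R[i]]_(fockdim L).

(* Jordan-Wigner: a_m |T> = (-1)^#{m' in T, m' before m} |T \ m> if m \in T,
   and 0 otherwise, for the enumeration order of the modes. *)
Definition ann (R : realType) (L : nat) (x : site L) (s : species) :
    fockop R L :=
  let m : mode L := (x, s) in
  \matrix_(i, j)
    let S : {set mode L} := enum_val i in
    let T : {set mode L} := enum_val j in
    if (m \in T) && (S == T :\ m)
    then (-1) ^+ #|[set m' in T | (enum_rank m' < enum_rank m)%N]| else 0.

Definition cre (R : realType) (L : nat) (x : site L) (s : species) :
  fockop R L := (ann R x s)^t*.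

Definition occ (R : realType) (L : nat) (x : site L) (s : species) :
  fockop R L := cre R x s *m ann R x s.

Definition hop (R : realType) (L : nat) (b : site L * site L) (s : species) :
    fockop R L :=
  cre R b.1 s *m ann R b.2 s + cre R b.2 s *m ann R b.1 s.

Definition Ntot (R : realType) (L : nat) : fockop R L :=
  \sum_x \sum_s occ R x s.

Definition Hfree (R : realType) (L : nat) (h : R) : fockop R L :=
  - h%:C *: (\sum_(b in bonds L) \sum_s hop R b s)
  + (6 * h)%:C *: (\sum_x \sum_s occ R x s).

Definition HC (R : realType) (L : nat) (C : R) : fockop R L :=
  (C / 2)%:C *: (\sum_x \sum_s \sum_(s' | s != s') occ R x s *m occ R x s').

Definition HD (R : realType) (L : nat) (D : R) : fockop R L :=
  (D / 6)%:C *: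
  (\sum_x \sum_s \sum_s' \sum_(s'' | [&& s != s', s' != s'' & s != s''])
     occ R x s *m occ R x s' *m occ R x s'').

Definition Heft (R : realType) (L : nat) (h C D : R) : fockop R L :=
  Hfree L h + HC L C + HD L D.

Definition Hhop (R : realType) (L : nat) (h : R)
    (W : {set site L * site L}) : fockop R L :=
  - h%:C *: (\sum_s \sum_(b in W) hop R b s)
  + h%:C *: (\sum_s \sum_x occ R x s).

(* Zero-based: the summands 0, ..., 5 are the hopping layers and the last one,
   ord_max, is the on-site interaction. *)
Definition Hlayer (R : realType) (L : nat) (h C D : R)
    (Omega : 'I_6 -> {set site L * site L}) (g : 'I_7) : fockop R L :=
  if unlift ord_max g is Some k then Hhop h (Omega k) else HC L C + HD L D.

Definition evol (R : realType) (L : nat) (t : R) (H : fockop R L) :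
  fockop R L := expmx ((- ('i * t%:C)) *: H).

(* \prod is ordered: the factor of the first layer is the leftmost. *)
Definition P1 (R : realType) (L : nat) (h C D : R)
    (Omega : 'I_6 -> {set site L * site L}) (t : R) : fockop R L :=
  \prod_(g < 7) evol t (Hlayer h C D Omega g).

Definition eta_state (R : realType) (L : nat) (eta : nat) (psi : fock R L) :
    Prop :=
  psi^t* *m psi = 1%:M /\ Ntot R L *m psi = eta%:R *: psi.

(* The supremum is a maximum as soon as there is a state with eta fermions
   (eta <= 4 L^3); otherwise it is sup set0 = 0. *)
Definition fnorm (R : realType) (L : nat) (eta : nat) (X : fockop R L) : R :=
  sup [set r | exists psi phi : fock R L,
    [/\ eta_state eta psi, eta_state eta phi &
        r = Normc.normc ((psi^t* *m X *m phi) 0 0)]]%classic.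

(* Main.v *)
Require Import Defs.
From mathcomp Require Import all_boot all_order all_algebra.
From mathcomp Require Import complex ring lra.
From mathcomp Require Import all_classical all_reals all_analysis.
(* After all_classical, so that set lemmas refer to finite sets. *)
From mathcomp Require Import finset.

(* On the sector with eta fermions, the error of the first-order formula is at
   most t^2/2 times the sum over g < g' of the norms of [H_g, H_g'].  For two
   terms A, B this needs no differentiation: with d = t/n, u = exp(-idA),
   v = exp(-idB) and w = exp(-id(A+B)), telescoping bounds u^n v^n - w^n by
   C(n,2) |[u,v]| + n |uv - w|, where [u,v] = -d^2 [A,B] + O(d^3) and
   uv - w = O(d^2); then n tends to infinity.

   Two hopping layers are -h dG(A) + h N and -h dG(A') + h N, where A, A' are
   adjacency matrices of matchings of the modes and dG is second quantization,
   so their commutator is h^2 dG(A A' - A' A).  The matrices A A' and A' A have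
   row and column sums at most 1, which makes |dG| <= eta for each of them:
   each of the 15 pairs contributes 2 h^2 eta.

   The interaction V is diagonal in the occupation basis.  By the Schur test
   the commutator of a hopping layer with V is bounded by its largest row sum,
   which is a sum over the disjoint bonds of the layer; a bond carrying m
   particles contributes at most h F(m), with
   F(m) = A1 (m %/ 2) + A2 (m %/ 3) + A3 (m %/ 4), and F is superadditive. *)

Set Implicit Arguments.
Unset Strict Implicit.
Unset Printing Implicit Defensive.

Import Order.TTheory GRing.Theory Num.Theory numFieldNormedType.Exports.
Local Open Scope ring_scope.
Local Open Scope complex_scope.
Local Open Scope sesquilinear_scope.

Notation normc := Normc.normc.

(** * Moduli of complex numbers *)

Section Modulus.
Variable R : rcfType.
Implicit Types (z : R[i]) (x : R).

Lemma normc_ge0 z : 0 <= normc z.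
Proof. by case: z => a b /=; exact: sqrtr_ge0. Qed.

Lemma normcR x : normc x%:C = `|x|.
Proof. by rewrite /= expr0n/= addr0 sqrtr_sqr. Qed.

Lemma normci : normc ('i%C : R[i]) = 1.
Proof. by rewrite /= expr0n/= add0r expr1n sqrtr1. Qed.

Lemma normc_conj z : normc z^*%C = normc z.
Proof. by case: z => a b /=; rewrite sqrrN. Qed.

Lemma normc_sum (I : Type) (r : seq I) (P : pred I) (F : I -> R[i]) :
  normc (\sum_(i <- r | P i) F i) <= \sum_(i <- r | P i) normc (F i).
Proof.
elim/big_ind2 : _ => [|x a y b xa yb|//]; first by rewrite Normc.normc0.
by apply: le_trans (le_normcD _ _) _; exact: lerD.
Qed.

End Modulus.

(** * Exponentials of Hermitian matrices *)

Section ExponentialSeries.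
Local Open Scope classical_set_scope.

(** There are finitely many entries, so their eventual bounds hold simultaneously; this is
    convergence in the matrix topology, where limits are unique. *)
Lemma expmx_unique (K : numFieldType) n (A B : 'M[K]_n) :
  (forall i j e, 0 < e -> \forall k \near \oo,
     `|B i j - (\sum_(0 <= m < k) m`!%:R^-1 *: A ^+ m) i j| < e) ->
  expmx A = B.
Proof.
move=> AB; apply/cvg_lim; first exact: norm_hausdorff.
apply/cvg_ballP => e e0.
suff : \forall k \near \oo, forall ij : 'I_n * 'I_n,
    `|B ij.1 ij.2 - (\sum_(0 <= m < k) m`!%:R^-1 *: A ^+ m) ij.1 ij.2| < e.
  by apply: filterS => k H; split => // i j; exact: (H (i, j)).

by apply: filter_forall => -[i j]; exact: AB.
Qed.

Lemma cvg_complex (R : realType) (a b : R^nat) (x y : R) :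
  (a @ \oo --> x) -> (b @ \oo --> y) ->
  forall e : R[i], 0 < e -> \forall k \near \oo, `|(x +i* y) - (a k +i* b k)| < e.
Proof.
move=> ax bY e e0.
have e'0 : 0 < complex.Re e by move: e0; rewrite ltcE => /andP[].
(* In the order on [R[i]], positivity forces the imaginary part to vanish. *)
have -> : e = (complex.Re e)%:C.
  by case: e e0 {e'0} => p q; rewrite ltcE /= => /andP[/eqP-> _].
have h0 : 0 < complex.Re e / 2 by rewrite divr_gt0.
move/cvgrPdist_lt : ax => /(_ _ h0) ax; move/cvgrPdist_lt : bY => /(_ _ h0) bY.
near=> k.
have -> : (x +i* y) - (a k +i* b k) = (x - a k)%:C + (y - b k)%:C * 'i%C.
  by simpc.
apply: le_lt_trans (ler_normD _ _) _.
have nE (z : R[i]) : `|z| = (normc z)%:C by [].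
rewrite normrM !nE normci mulr1 !normcR -rmorphD ltcR.
rewrite [ltRHS]splitr; apply: ltrD; near: k; [exact: ax|exact: bY].
Unshelve. all: by end_near. Qed.

(** The real and imaginary parts of the partial sums of exp(-ix) are exactly the partial sums of the
    cosine series and of minus the sine series. *)
Lemma cis_series (R : realType) (x : R) (e : R[i]) : 0 < e ->
  \forall k \near \oo,
  `|cos x -i* sin x - \sum_(0 <= m < k) m`!%:R^-1 * (- ('i%C * x%:C)) ^+ m| < e.
Proof.
move=> e0.
have cs : series (cos_coeff x) @ \oo --> cos x.
  by rewrite unlock; exact: is_cvg_series_cos_coeff.
have sn : (fun k => - series (sin_coeff x) k) @ \oo --> - sin x.
  by apply: cvgN; rewrite unlock; exact: is_cvg_series_sin_coeff.
have := cvg_complex cs sn e0; apply: filterS => k.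
suff -> : series (cos_coeff x) k -i* series (sin_coeff x) k =
          \sum_(0 <= m < k) m`!%:R^-1 * (- ('i%C * x%:C)) ^+ m by [].
elim: k => [|k IH]; first by rewrite /series /= !big_geq // oppr0.
rewrite big_nat_recr //= -IH /series /= !big_nat_recr //=.
have -> : k`!%:R^-1 * (- ('i * x%:C)) ^+ k = cos_coeff x k -i* sin_coeff x k.
  rewrite -mulrN exprMn -rmorphN -rmorphXn.
  have -> : (k`!%:R^-1 : R[i]) = (k`!%:R^-1)%:C by rewrite fmorphV rmorph_nat.
  have -> : 'i ^+ k = (((-1) ^+ k./2)%:C * 'i ^+ odd k) :> R[i].
    rewrite -[in LHS](odd_double_half k) exprD mulrC -mul2n exprM sqr_i.
    by rewrite rmorphXn rmorphN1.
  rewrite (exprNn x k) -(signr_odd _ k) /cos_coeff /sin_coeff /=.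
  case: (boolP (odd k)) => ok /=.
    have -> : k.-1./2 = k./2.
      by case: k {IH} ok => // k'; rewrite /= => /negPf ok; rewrite uphalf_half ok.
    by rewrite !expr1 -?exprnP; simpc; congr Complex; ring.
  by rewrite !expr0 -?exprnP; simpc; congr Complex; ring.
by simpc; congr Complex; rewrite opprD.
Qed.

End ExponentialSeries.

(** * The phase exp(-ix) and its Taylor bounds *)

Section Cis.
Variable R : realType.
Implicit Types x y : R.

(** This is exp(-ix): the sign is that of the time evolution, so an eigenvalue [d] evolves by
    [cis (t * d)]. *)
Definition cis x : R[i] := cos x -i* sin x.

Lemma cis0 : cis 0 = 1.
Proof. by rewrite /cis cos0 sin0 oppr0. Qed.

Lemma cisD x y : cis (x + y) = cis x * cis y.
Proof.
rewrite /cis cosD sinD [RHS]/GRing.mul /=; congr Complex; ring.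
Qed.

Lemma conjc_cis x : (cis x)^*%C = cis (- x).
Proof. by rewrite /cis cosN sinN /= opprK. Qed.

Lemma sin_le_norm x : `|sin x| <= `|x|.
Proof.
wlog x0 : x / 0 <= x.
  move=> H; case: (leP 0 x) => [|/ltW x0]; first exact: H.
  by rewrite -[`|x|]normrN -[`|sin x|]normrN -sinN H // oppr_ge0.
have [c _] := @MVT_segment R sin cos 0 x x0 (fun y _ => is_derive_sin y)
  (continuous_subspaceT (@continuous_sin R)).
by rewrite sin0 !subr0 => ->; rewrite normrM ler_piMl // cos_max.
Qed.

(** Mean value theorem with |sin c| <= |c|. The sharp factor 1/2 is not sought: only the order
    matters, since these remainders vanish in the limit of many time steps. *)
Lemma cos_taylor x : `|1 - cos x| <= x ^+ 2.
Proof.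
wlog x0 : x / 0 <= x.
  move=> H; case: (leP 0 x) => [|/ltW x0]; first exact: H.
  by rewrite -cosN -sqrrN H // oppr_ge0.
have [c] := @MVT_segment R cos (fun y => - sin y) 0 x x0
  (fun y _ => is_derive_cos y) (continuous_subspaceT (@continuous_cos R)).
rewrite in_itv /= => /andP[c0 cx].
rewrite cos0 subr0 distrC => ->; rewrite normrM normrN expr2.
rewrite (ger0_norm x0) ler_wpM2r //.
by rewrite (le_trans (sin_le_norm c)) // ger0_norm.
Qed.

Lemma sin_taylor x : `|x - sin x| <= `|x| * x ^+ 2.
Proof.
wlog x0 : x / 0 <= x.
  move=> H; case: (leP 0 x) => [|/ltW x0]; first exact: H.
  have := H (- x); rewrite sinN -opprD !normrN sqrrN; apply.
  by rewrite oppr_ge0.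
have d y : is_derive y 1 (fun z : R => z - sin z) (1 - cos y).
  exact: is_deriveB.
have [c] := @MVT_segment R (fun z => z - sin z) (fun y => 1 - cos y) 0 x x0
  (fun y _ => d y) (continuous_subspaceT (fun y => differentiable_continuous
     (proj1 (derivable1_diffP _ _) (@ex_derive _ _ _ _ _ _ _ (d y))))).
rewrite in_itv /= => /andP[c0 cx].
rewrite sin0 !subr0 => ->; rewrite normrM mulrC ler_wpM2l //.
by rewrite (le_trans (cos_taylor c)) // lerXn2r // nnegrE.
Qed.

Lemma cis_taylor x :
  normc (cis x - 1 + 'i%C * x%:C) <= x ^+ 2 + `|x| * x ^+ 2.
Proof.
have -> : cis x - 1 + 'i%C * x%:C = (cos x - 1)%:C + (x - sin x)%:C * 'i%C.
  by rewrite /cis; simpc; congr Complex; ring.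
apply: le_trans (le_normcD _ _) _.
rewrite Normc.normcM normci mulr1 !normcR.
by rewrite lerD // ?sin_taylor // distrC cos_taylor.
Qed.

End Cis.

(** * An entrywise matrix norm, and adjoints *)

Section L1.
Variables (R : realType).

(** A submultiplicative norm, used for remainder terms whose constants may depend on the
    dimension. *)
Definition l1norm m n (X : 'M[R[i]]_(m, n)) : R := \sum_i \sum_j normc (X i j).

Lemma l1norm_ge0 m n (X : 'M[R[i]]_(m, n)) : 0 <= l1norm X.
Proof. by apply: sumr_ge0 => i _; apply: sumr_ge0 => j _; exact: normc_ge0. Qed.

Lemma l1normD m n (X Y : 'M[R[i]]_(m, n)) : l1norm (X + Y) <= l1norm X + l1norm Y.
Proof.
rewrite /l1norm -big_split; apply: ler_sum => i _.
rewrite -big_split; apply: ler_sum => j _; rewrite mxE; exact: le_normcD.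
Qed.

Lemma l1normZ m n a (X : 'M[R[i]]_(m, n)) : l1norm (a *: X) = normc a * l1norm X.
Proof.
rewrite /l1norm mulr_sumr; apply: eq_bigr => i _.
by rewrite mulr_sumr; apply: eq_bigr => j _; rewrite mxE Normc.normcM.
Qed.

Lemma l1normN m n (X : 'M[R[i]]_(m, n)) : l1norm (- X) = l1norm X.
Proof.
by apply: eq_bigr => i _; apply: eq_bigr => j _; rewrite mxE normcN.
Qed.

Lemma le_l1norm m n (X : 'M[R[i]]_(m, n)) i : \sum_j normc (X i j) <= l1norm X.
Proof.
rewrite /l1norm (bigD1 i) //= lerDl; apply: sumr_ge0 => k _.
by apply: sumr_ge0 => j _; exact: normc_ge0.
Qed.

Lemma l1normM m n p (X : 'M[R[i]]_(m, n)) (Y : 'M[R[i]]_(n, p)) :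
  l1norm (X *m Y) <= l1norm X * l1norm Y.
Proof.
rewrite /l1norm mulr_suml; apply: ler_sum => i _.
apply: (@le_trans _ _ (\sum_j \sum_k normc (X i k) * normc (Y k j))).
  apply: ler_sum => j _; rewrite mxE; apply: le_trans (normc_sum _ _ _) _.
  by apply: ler_sum => k _; rewrite Normc.normcM.
rewrite exchange_big mulr_suml; apply: ler_sum => k _ /=.
by rewrite -mulr_sumr ler_wpM2l ?normc_ge0 // le_l1norm.
Qed.

Lemma l1norm_diag n (d : 'rV[R[i]]_n) : l1norm (diag_mx d) = \sum_j normc (d 0 j).
Proof.
apply: eq_bigr => i _; rewrite (bigD1 i) //= big1 => [|j ji].
  by rewrite mxE eqxx mulr1n addr0.
by rewrite mxE eq_sym (negPf ji) mulr0n Normc.normc0.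
Qed.

End L1.

Section Dagger.
Variable R : realType.

Definition dag m n (X : 'M[R[i]]_(m, n)) : 'M[R[i]]_(n, m) :=
  \matrix_(i, j) (X j i)^*%C.

Lemma dagE m n (X : 'M[R[i]]_(m, n)) : dag X = X^t*.
Proof. by apply/matrixP => i j; rewrite !mxE. Qed.

Lemma dagK m n (X : 'M[R[i]]_(m, n)) : dag (dag X) = X.
Proof. by apply/matrixP => i j; rewrite !mxE conjcK. Qed.

Lemma dagD m n (X Y : 'M[R[i]]_(m, n)) : dag (X + Y) = dag X + dag Y.
Proof. by apply/matrixP => i j; rewrite !mxE rmorphD. Qed.

Lemma dag0 m n : dag (0 : 'M[R[i]]_(m, n)) = 0.
Proof. by apply/matrixP => i j; rewrite !mxE rmorph0. Qed.

Lemma dag_sum m n (I : Type) (r : seq I) (P : pred I) (F : I -> 'M[R[i]]_(m, n)) :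
  dag (\sum_(i <- r | P i) F i) = \sum_(i <- r | P i) dag (F i).
Proof. exact: (big_morph _ (@dagD m n) (dag0 m n)). Qed.

Lemma dagZ m n a (X : 'M[R[i]]_(m, n)) : dag (a *: X) = a^*%C *: dag X.
Proof. by apply/matrixP => i j; rewrite !mxE rmorphM. Qed.

Lemma dagZr m n (a : R) (X : 'M[R[i]]_(m, n)) : dag (a%:C *: X) = a%:C *: dag X.
Proof. by rewrite dagZ conjc_real. Qed.

Lemma dagM m n p (X : 'M[R[i]]_(m, n)) (Y : 'M[R[i]]_(n, p)) :
  dag (X *m Y) = dag Y *m dag X.
Proof.
apply/matrixP => i j; rewrite !mxE rmorph_sum; apply: eq_bigr => k _.
by rewrite rmorphM mulrC !mxE.
Qed.

Lemma dag_diag n (d : 'rV[R[i]]_n) :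
  dag (diag_mx d) = diag_mx (\row_j (d 0 j)^*%C).
Proof.
apply/matrixP => i j; rewrite !mxE eq_sym.
by case: eqP => [->|_]; rewrite ?mulr1n ?mulr0n ?rmorph0.
Qed.

End Dagger.

(** * Unitary groups through the spectral theorem *)

Section UnitaryGroup.
Variables (R : realType) (n : nat).
Implicit Types (A N P : 'M[R[i]]_n) (t : R).

(* [evol t A] is [ugroup A t] by definition. *)
Definition ugroup A t : 'M[R[i]]_n := expmx ((- ('i%C * t%:C)) *: A).

Definition cisdiag (d : 'I_n -> R) t : 'M[R[i]]_n := diag_mx (\row_j cis (t * d j)).

Definition realdiag (d : 'I_n -> R) : 'M[R[i]]_n := diag_mx (\row_j (d j)%:C).

Lemma hermitian_spectral A : dag A = A ->
  exists P d, [/\ P *m dag P = 1%:M, dag P *m P = 1%:M &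
                  A = dag P *m realdiag d *m P].
Proof.
move=> hA; have Ah : A \is hermsymmx.
  by apply/is_hermitianmxP; rewrite expr0 scale1r -dagE hA.
have := hermitian_spectral_diag_real Ah.
have /hermitian_normalmx /orthomx_spectralP := Ah.
move: (spectralmx A) (spectral_diag A) (spectral_unitarymx A) => P D Pu AE Dr.
have PP : P *m dag P = 1%:M by rewrite dagE; exact/unitarymxP.
exists P, (fun j => complex.Re (D 0 j)); split; [exact PP|exact (mulmx1C PP)|].
have DE : \row_j (complex.Re (D 0 j))%:C = D.
  by apply/rowP => j; rewrite mxE RRe_real //; move/mxOverP: Dr; exact.
by rewrite /realdiag DE dagE -(invmx_unitary Pu).
Qed.

Lemma mulmxKC m P (X : 'M[R[i]]_(m, n)) : P *m dag P = 1%:M -> X *m P *m dag P = X.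
Proof. by move=> PP; rewrite -mulmxA PP mulmx1. Qed.

Lemma expmxS (X : 'M[R[i]]_n) k : X ^+ k.+1 = X *m X ^+ k.
Proof. exact: exprS. Qed.

Lemma mulmx_conj_exp P (D : 'M[R[i]]_n) k : P *m dag P = 1%:M ->
  (dag P *m D *m P) ^+ k = dag P *m D ^+ k *m P.
Proof.
move=> PP; elim: k => [|k IH].
  by rewrite !expr0 mulmx1 (mulmx1C PP).
rewrite !expmxS IH; move: (D ^+ k) => E.
by rewrite !mulmxA (mulmxKC (dag P *m D) PP).
Qed.

(** Conjugation by [P] passes through every power, so each entry of the series is a fixed
    combination of scalar exponential series at the eigenvalues. *)
Lemma ugroup_spectral P d t : P *m dag P = 1%:M ->
  ugroup (dag P *m realdiag d *m P) t = dag P *m cisdiag d t *m P.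
Proof.
move=> PP; apply: expmx_unique => i j e e0.
pose c l : R[i] := `|dag P i l| * `|P l j|.
have c0 : 0 <= \sum_l c l by apply: sumr_ge0 => l _; rewrite mulr_ge0.
(* The tolerance per eigenvalue; the added 1 avoids division by zero and makes the final estimate
   strict. *)
have e'0 : 0 < e / (1 + \sum_l c l) by rewrite divr_gt0 // ltr_pwDl.
have near_l : \forall k \near (\oo)%classic, forall l : 'I_n,
    `|cis (t * d l) - \sum_(0 <= m < k) m`!%:R^-1 * (- ('i%C * (t * d l)%:C)) ^+ m|
    < e / (1 + \sum_l c l).
  by apply: filter_forall => l; exact: cis_series.
apply: filterS near_l => k Hk.
have -> : \sum_(0 <= m < k) m`!%:R^-1 *:
      (- ('i%C * t%:C) *: (dag P *m realdiag d *m P)) ^+ m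
    = dag P *m diag_mx (\row_l \sum_(0 <= m < k)
         m`!%:R^-1 * (- ('i%C * (t * d l)%:C)) ^+ m) *m P.
  rewrite scalemxAl scalemxAr.
  have E m : (dag P *m (- ('i%C * t%:C) *: realdiag d) *m P) ^+ m =
     dag P *m diag_mx (\row_l (- ('i%C * (t * d l)%:C)) ^+ m) *m P.
    rewrite (mulmx_conj_exp _ _ PP).
congr (_ *m _ *m _).
    elim: m => [|m IH].
      by apply/matrixP => a b; rewrite expr0 !mxE expr0.
    rewrite expmxS IH -scalemxAl mulmx_diag -linearZ /=; congr diag_mx.
    apply/rowP => l; rewrite !mxE exprS.
    by rewrite (rmorphM (real_complex R) t (d l)) /=; ring.
  under eq_bigr do rewrite E scalemxAl scalemxAr.
  rewrite -mulmx_suml -mulmx_sumr; congr (_ *m _ *m _).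
  under eq_bigr do rewrite -linearZ /=.
  rewrite -linear_sum /=; congr diag_mx.
  by apply/rowP => l; rewrite summxE mxE; apply: eq_bigr => m _; rewrite !mxE.
have entry (D : 'rV[R[i]]_n) : (dag P *m diag_mx D *m P) i j =
    \sum_l dag P i l * P l j * D 0 l.
  rewrite mul_mx_diag mxE; apply: eq_bigr => l _; rewrite !mxE; ring.
rewrite /cisdiag.
rewrite entry.
rewrite entry.
rewrite -sumrB.
apply: le_lt_trans (ler_norm_sum _ _ _) _.
apply: (@le_lt_trans _ _ (\sum_l c l * (e / (1 + \sum_l c l)))).
  apply: ler_sum => l _; rewrite -mulrBr normrM normrM ler_wpM2l ?mulr_ge0 //.
  by rewrite !mxE; exact: ltW (Hk l).
rewrite -mulr_suml mulrCA gtr_pMr // ltr_pdivrMr ?ltr_pwDl // mul1r.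
by rewrite ltrDr.
Qed.

Lemma ugroup_unitary A t : dag A = A ->
  dag (ugroup A t) *m ugroup A t = 1%:M /\ ugroup A t *m dag (ugroup A t) = 1%:M.
Proof.
move=> /hermitian_spectral [P [d [PP PP' ->]]].
suff H : dag (ugroup (dag P *m realdiag d *m P) t) *m
     ugroup (dag P *m realdiag d *m P) t = 1%:M by split=> //; exact: mulmx1C.
rewrite (ugroup_spectral d t PP) !dagM dagK !mulmxA (mulmxKC (dag P *m _) PP).
have E : dag (cisdiag d t) *m cisdiag d t = 1%:M.
  rewrite /cisdiag dag_diag mulmx_diag -diag_const_mx; congr diag_mx.
  by apply/rowP => j; rewrite !mxE conjc_cis -cisD addNr cis0.
by rewrite -[X in X *m P]mulmxA E mulmx1.
Qed.

Lemma ugroupD A s t : dag A = A -> ugroup A (s + t) = ugroup A s *m ugroup A t.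
Proof.
move=> /hermitian_spectral [P [d [PP PP' ->]]].
rewrite !ugroup_spectral // !mulmxA (mulmxKC _ PP).
rewrite -[X in _ = X *m P]mulmxA mulmx_diag; congr (_ *m _ *m _).
by congr diag_mx; apply/rowP => j; rewrite !mxE mulrDl cisD.
Qed.

Lemma ugroup0 A : dag A = A -> ugroup A 0 = 1%:M.
Proof.
move=> /hermitian_spectral [P [d [PP PP' ->]]].
rewrite (ugroup_spectral d 0 PP) (_ : cisdiag d 0 = 1%:M) ?mulmx1 //.
rewrite -diag_const_mx; congr diag_mx; apply/rowP => j; rewrite !mxE.
by rewrite mul0r cis0.
Qed.

Lemma ugroup_expn A t k : dag A = A -> ugroup A (k%:R * t) = ugroup A t ^+ k.
Proof.
move=> hA; elim: k => [|k IH]; first by rewrite mul0r ugroup0.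
by rewrite exprS -natr1 addrC mulrDl mul1r ugroupD // IH.
Qed.

(** A matrix commuting with a diagonal one only connects indices with equal eigenvalues, and there
    the phases agree too. *)
Lemma comm_cisdiag d t (X : 'M[R[i]]_n) :
  X *m realdiag d = realdiag d *m X -> X *m cisdiag d t = cisdiag d t *m X.
Proof.
move=> XD; apply/matrixP => i j; move/matrixP/(_ i j): XD.
rewrite !mul_mx_diag !mul_diag_mx !mxE => H.
have [->|dij] := eqVneq (d i) (d j); first by rewrite mulrC.
suff -> : X i j = 0 by rewrite mul0r mulr0.
move/eqP: H; rewrite mulrC -subr_eq0 -mulrBl mulf_eq0 -rmorphB /=.
move=> /orP[|/eqP//]; rewrite (inj_eq (@complexI _) _ 0) subr_eq0 => /eqP E.
by rewrite E eqxx in dij.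
Qed.

Lemma ugroup_comm A N t : dag A = A -> N *m A = A *m N ->
  N *m ugroup A t = ugroup A t *m N.
Proof.
move=> /hermitian_spectral [P [d [PP PP' ->]]] NA.
rewrite (ugroup_spectral d t PP).
pose N' := P *m N *m dag P.
have ND : N' *m realdiag d = realdiag d *m N'.
  have := congr1 (fun X => P *m X *m dag P) NA; move: NA => _ /=.
  rewrite /N' !mulmxA (mulmxKC _ PP) PP mul1mx; exact.
have NE := comm_cisdiag t ND.
have := congr1 (fun X => dag P *m X *m P) NE; move: NE => _ /=.
rewrite /N' !mulmxA PP' mul1mx => ->.
by rewrite -!mulmxA PP' mulmx1.
Qed.

(** In an eigenbasis the remainder is diagonal, and [cis_taylor] applies at each [t * d j]; [K]
    collects the powers of the eigenvalues and the norms of the change of basis. *)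
Lemma ugroup_taylor A : dag A = A -> exists2 K : R, 0 <= K &
  forall t, l1norm (ugroup A t - 1%:M + ('i%C * t%:C) *: A)
            <= K * (t ^+ 2 + `|t| * t ^+ 2).
Proof.
move=> /hermitian_spectral [P [d [PP PP' ->]]].
pose K := l1norm (dag P) * (\sum_j (d j ^+ 2 + `|d j| * d j ^+ 2)) * l1norm P.
have dj j : 0 <= d j ^+ 2 + `|d j| * d j ^+ 2.
  apply: addr_ge0; [exact: sqr_ge0|apply: mulr_ge0; [exact: normr_ge0|exact: sqr_ge0]].
exists K => [|t].
  by rewrite !mulr_ge0 ?l1norm_ge0 // sumr_ge0.
rewrite (ugroup_spectral d t PP).
have -> : dag P *m cisdiag d t *m P - 1%:M + 'i%C * t%:C *: (dag P *m realdiag d *m P)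
  = dag P *m diag_mx (\row_j (cis (t * d j) - 1 + 'i%C * (t * d j)%:C)) *m P.
  rewrite scalemxAl scalemxAr -{1}PP' -[dag P in X in _ - X]mulmx1.
  rewrite -mulmxBl -mulmxBr -mulmxDl -mulmxDr; congr (_ *m _ *m _).
  rewrite -diag_const_mx -linearZ -linearB -linearD /=; congr diag_mx.
  apply/rowP => j; rewrite !mxE.
  by rewrite (rmorphM (real_complex R) t (d j)) /= !mulrA.
apply: le_trans (l1normM _ _) _.
rewrite [leRHS]mulrAC ler_wpM2r ?l1norm_ge0 //.
apply: le_trans (l1normM _ _) _.
rewrite -mulrA ler_wpM2l ?l1norm_ge0 // l1norm_diag mulr_suml.
apply: ler_sum => j _; rewrite mxE; apply: le_trans (cis_taylor _) _.
rewrite normrM exprMn -subr_ge0.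
have sq (z : R) : 0 <= z ^+ 2 by exact: sqr_ge0.
rewrite (_ : _ - _ =
   `|d j| * d j ^+ 2 * t ^+ 2 + d j ^+ 2 * `|t| * t ^+ 2); last by ring.
by apply: addr_ge0; apply: mulr_ge0 => //; apply: mulr_ge0.
Qed.

End UnitaryGroup.

(** * Bounds on a symmetry sector and the product formula *)

Lemma sub_chain (V : zmodType) (x y z : V) : x - z = x - y + (y - z).
Proof. by rewrite addrA subrK. Qed.

Lemma sub_chain3 (V : zmodType) (x y z t : V) : x - t = z - t + (x - y + (y - z)).
Proof. by rewrite -sub_chain [RHS]addrC -sub_chain. Qed.

Section Commutator.
Variables (R : realType) (n : nat).
Implicit Types X Y Z : 'M[R[i]]_n.

Definition comm X Y := X *m Y - Y *m X.

Lemma comm_swap X Y : comm Y X = - comm X Y.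
Proof. by rewrite /comm opprB. Qed.

Lemma comm_eq0 X Y : comm X Y = 0 -> X *m Y = Y *m X.
Proof. by move=> /eqP; rewrite subr_eq0 => /eqP. Qed.

Lemma commDl X Y Z : comm (X + Y) Z = comm X Z + comm Y Z.
Proof. by rewrite /comm mulmxDl mulmxDr opprD addrACA. Qed.

Lemma commDr X Y Z : comm X (Y + Z) = comm X Y + comm X Z.
Proof. by rewrite /comm mulmxDl mulmxDr opprD addrACA. Qed.

Lemma commZl a X Y : comm (a *: X) Y = a *: comm X Y.
Proof. by rewrite /comm scalerBr -scalemxAl -scalemxAr. Qed.

Lemma commZr a X Y : comm X (a *: Y) = a *: comm X Y.
Proof. by rewrite /comm scalerBr -scalemxAl -scalemxAr. Qed.

Lemma comm1l X : comm 1%:M X = 0.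
Proof. by rewrite /comm mul1mx mulmx1 subrr. Qed.

Lemma comm1r X : comm X 1%:M = 0.
Proof. by rewrite /comm mul1mx mulmx1 subrr. Qed.

Lemma comm_sumr X (I : Type) (r : seq I) (P : pred I) (F : I -> 'M[R[i]]_n) :
  comm X (\sum_(i <- r | P i) F i) = \sum_(i <- r | P i) comm X (F i).
Proof. by rewrite /comm mulmx_sumr mulmx_suml sumrB. Qed.

Lemma comm_suml X (I : Type) (r : seq I) (P : pred I) (F : I -> 'M[R[i]]_n) :
  comm (\sum_(i <- r | P i) F i) X = \sum_(i <- r | P i) comm (F i) X.
Proof. by rewrite /comm mulmx_sumr mulmx_suml sumrB. Qed.

Lemma l1norm_comm X Y : l1norm (comm X Y) <= 2 * l1norm X * l1norm Y.
Proof.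
apply: le_trans (l1normD _ _) _; rewrite l1normN -mulrA mulr_natl mulr2n.
by rewrite lerD ?l1normM // mulrC l1normM.
Qed.

End Commutator.

Section Sector.
Variables (R : realType) (n : nat) (N : 'M[R[i]]_n) (mu : R[i]).
Implicit Types (X Y W : 'M[R[i]]_n) (psi phi : 'cV[R[i]]_n) (c : R).

Definition sector_state psi := dag psi *m psi = 1%:M /\ N *m psi = mu *: psi.

(** The statement that the sector norm of [X] is at most [c], phrased without a supremum, so that an
    empty sector needs no separate treatment. *)
Definition sector_bound X c := forall psi phi,
  sector_state psi -> sector_state phi -> normc ((dag psi *m X *m phi) 0 0) <= c.

(** Unitaries preserving the sector: multiplication by them on either side keeps a
    [sector_bound]. *)
Definition symmetry W :=
  [/\ dag W *m W = 1%:M, W *m dag W = 1%:M & N *m W = W *m N].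

Lemma state_normc2 psi : dag psi *m psi = 1%:M -> \sum_i normc (psi i 0) ^+ 2 = 1.
Proof.
move=> /matrixP/(_ 0 0); rewrite !mxE eqxx mulr1n => H.
apply: (@complexI R); rewrite rmorph_sum rmorph1 -H; apply: eq_bigr => i _.
by rewrite mxE mulrC rmorphXn -sqr_normc.
Qed.

Lemma state_normc_le1 psi i : dag psi *m psi = 1%:M -> normc (psi i 0) <= 1.
Proof.
move=> /state_normc2 H; rewrite -(@ler_pXn2r _ 2) ?nnegrE ?normc_ge0 //.
rewrite expr1n -H (bigD1 i) //= lerDl sumr_ge0 // => j _; exact: sqr_ge0.
Qed.

Lemma sector_bound_le X c d : c <= d -> sector_bound X c -> sector_bound X d.
Proof. by move=> cd Xc psi phi hpsi hphi; apply: le_trans cd; exact: Xc. Qed.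

Lemma sector_boundD X Y c d : sector_bound X c -> sector_bound Y d ->
  sector_bound (X + Y) (c + d).
Proof.
move=> Xc Yd psi phi hpsi hphi; rewrite mulmxDr mulmxDl mxE.
by apply: le_trans (le_normcD _ _) _; rewrite lerD ?Xc ?Yd.
Qed.

Lemma sector_boundN X c : sector_bound X c -> sector_bound (- X) c.
Proof.
by move=> Xc psi phi hpsi hphi; rewrite mulmxN mulNmx mxE normcN; exact: Xc.
Qed.

Lemma sector_bound0 : sector_bound 0 0.
Proof. by move=> psi phi _ _; rewrite mulmx0 mul0mx mxE Normc.normc0. Qed.

Lemma sector_bound_sum (I : Type) (r : seq I) (P : pred I) F (c : I -> R) :
  (forall i, P i -> sector_bound (F i) (c i)) ->
  sector_bound (\sum_(i <- r | P i) F i) (\sum_(i <- r | P i) c i).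
Proof.
move=> H; elim/big_ind2 : _ => //; first exact: sector_bound0.
by move=> *; exact: sector_boundD.
Qed.

Lemma sector_boundZ a X c : sector_bound X c -> sector_bound (a *: X) (normc a * c).
Proof.
move=> Xc psi phi hpsi hphi; rewrite -scalemxAr -scalemxAl mxE Normc.normcM.
by rewrite ler_wpM2l ?normc_ge0 ?Xc.
Qed.

(** Every component of a normalized state has modulus at most 1. *)
Lemma sector_bound_l1norm X : sector_bound X (l1norm X).
Proof.
move=> psi phi [hpsi _] [hphi _]; rewrite -mulmxA mxE.
apply: le_trans (normc_sum _ _ _) _; apply: ler_sum => i _.
rewrite Normc.normcM [dag _ _ _]mxE normc_conj.
apply: (@le_trans _ _ (normc ((X *m phi) i 0))).
  by rewrite ler_piMl ?normc_ge0 // state_normc_le1.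
rewrite mxE; apply: le_trans (normc_sum _ _ _) _; apply: ler_sum => j _.
by rewrite Normc.normcM ler_piMr ?normc_ge0 // state_normc_le1.
Qed.

Lemma symmetry1 : symmetry 1%:M.
Proof.
have E : dag (1%:M : 'M[R[i]]_n) = 1%:M.
  by apply/matrixP => i j; rewrite !mxE eq_sym rmorph_nat.
by split; rewrite ?E mulmx1 ?mul1mx.
Qed.

Lemma symmetryM W X : symmetry W -> symmetry X -> symmetry (W *m X).
Proof.
move=> [W1 W2 W3] [X1 X2 X3]; split.
- by rewrite dagM !mulmxA -[X in X *m _]mulmxA W1 mulmx1.
- by rewrite dagM !mulmxA -[X in X *m _]mulmxA X2 mulmx1.
- by rewrite mulmxA W3 -!mulmxA X3.
Qed.

Lemma symmetryX W k : symmetry W -> symmetry (W ^+ k).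
Proof.
move=> hW; elim: k => [|k IH]; first exact: symmetry1.
by rewrite expmxS; exact: symmetryM.
Qed.

Lemma symmetry_state W psi : symmetry W -> sector_state psi -> sector_state (W *m psi).
Proof.
move=> [W1 _ W3] [p1 p2]; split; last by rewrite mulmxA W3 -mulmxA p2 scalemxAr.
by rewrite dagM -mulmxA [dag W *m _]mulmxA W1 mul1mx.
Qed.

(** Commutation with [N] follows by multiplying [N W = W N] by the adjoint of [W] on both sides. *)
Lemma symmetry_dag W : symmetry W -> symmetry (dag W).
Proof.
move=> [W1 W2 W3]; split; rewrite ?dagK //.
rewrite -[LHS]mul1mx -W1 -!mulmxA; congr (_ *m _).
by rewrite !mulmxA -W3 -mulmxA W2 mulmx1.
Qed.

Lemma sector_bound_mull W X c :
  symmetry W -> sector_bound X c -> sector_bound (W *m X) c.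
Proof.
move=> hW Xc psi phi hpsi hphi.
rewrite mulmxA -[W]dagK -dagM; apply: Xc => //.
exact/symmetry_state/hpsi/symmetry_dag.
Qed.

Lemma sector_bound_mulr W X c :
  symmetry W -> sector_bound X c -> sector_bound (X *m W) c.
Proof.
move=> hW Xc psi phi hpsi hphi.
by rewrite mulmxA -[_ *m W *m _]mulmxA; apply: Xc => //; exact: symmetry_state.
Qed.

(** Leibniz rule: u^(k+1) contributes one more copy of [u,v], multiplied by unitaries. *)
Lemma sector_bound_comm_pow u v c k : symmetry u -> sector_bound (comm u v) c ->
  sector_bound (comm (u ^+ k) v) (k%:R * c).
Proof.
move=> hu uv; elim: k => [|k IH].
  by rewrite expr0 comm1l mul0r; exact: sector_bound0.
have -> : comm (u ^+ k.+1) v = u *m comm (u ^+ k) v + comm u v *m u ^+ k.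
  rewrite expmxS /comm; move: (u ^+ k) => U.
  rewrite mulmxBr mulmxBl !mulmxA; exact: sub_chain.
rewrite -natr1 mulrDl mul1r; apply: sector_boundD.
  exact: sector_bound_mull.
by apply: sector_bound_mulr => //; exact: symmetryX.
Qed.

(** Passing from k to k+1, one [v] is moved left past u^k, which costs k commutators, and one
    product uv is replaced by [w]. Summing k over the steps gives the binomial coefficient. *)
Lemma sector_bound_trotter_pow u v w c d k :
  symmetry u -> symmetry v -> symmetry w ->
  sector_bound (comm u v) c -> sector_bound (u *m v - w) d ->
  sector_bound (u ^+ k *m v ^+ k - w ^+ k) ('C(k, 2)%:R * c + k%:R * d).
Proof.
move=> hu hv hw uv uvw; elim: k => [|k IH].
  by rewrite !expr0 mulmx1 subrr bin0n /= !mul0r addr0; exact: sector_bound0.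
have -> : u ^+ k.+1 *m v ^+ k.+1 - w ^+ k.+1 =
   w *m (u ^+ k *m v ^+ k - w ^+ k) +
   (u *m (comm (u ^+ k) v *m v ^+ k) + (u *m v - w) *m (u ^+ k *m v ^+ k)).
  rewrite !expmxS /comm; move: (u ^+ k) (v ^+ k) (w ^+ k) => U V W.
  rewrite !(mulmxBr, mulmxBl) !mulmxA; exact: sub_chain3.
rewrite binS bin1 natrD -natr1.
rewrite [X in sector_bound _ X](_ : _ =
   ('C(k, 2)%:R * c + k%:R * d) + (k%:R * c + d)); last by ring.
apply: sector_boundD; first exact: sector_bound_mull.
apply: sector_boundD.
  apply: sector_bound_mull => //; apply: sector_bound_mulr; first exact: symmetryX.
  exact: sector_bound_comm_pow.
by apply: sector_bound_mulr => //; apply: symmetryM; exact: symmetryX.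
Qed.

Lemma ugroup_symmetry A t : dag A = A -> N *m A = A *m N -> symmetry (ugroup A t).
Proof.
move=> hA NA; have [H1 H2] := ugroup_unitary t hA.
by split=> //; exact: ugroup_comm.
Qed.

End Sector.

(** * Error of the product formula *)

Section Trotter.
Variables (R : realType) (n : nat).
Implicit Types A B E X : 'M[R[i]]_n.

Lemma ugroup_taylor1 A : dag A = A -> exists2 K : R, 0 <= K &
  forall t : R, `|t| <= 1 -> exists2 E, ugroup A t = 1%:M + (- ('i%C * t%:C) *: A + E)
    & l1norm E <= K * t ^+ 2.
Proof.
move=> /ugroup_taylor [K K0 HK]; exists (2 * K) => [|t t1]; first by rewrite mulr_ge0.
exists (ugroup A t - 1%:M + ('i%C * t%:C) *: A).
  move: (ugroup A t) (1%:M : 'M[R[i]]_n) => V I.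
  by apply/matrixP => i j; rewrite !mxE; ring.
apply: le_trans (HK t) _; rewrite -[leRHS]mulrA [leRHS]mulrCA ler_wpM2l //.
by rewrite mulr_natl mulr2n lerD // ler_piMl ?sqr_ge0.
Qed.

Lemma normc_it (t : R) : normc (- ('i%C * t%:C)) = `|t|.
Proof. by rewrite normcN Normc.normcM normci mul1r normcR. Qed.

Lemma ugroup_first_order A : dag A = A -> exists2 K : R, 0 <= K &
  forall t : R, `|t| <= 1 -> exists E X,
   [/\ ugroup A t = 1%:M + X, X = - ('i%C * t%:C) *: A + E,
       l1norm E <= K * t ^+ 2 & l1norm X <= K * `|t|].
Proof.
move=> /ugroup_taylor1 [K K0 HK]; exists (K + l1norm A).
  by rewrite addr_ge0 ?l1norm_ge0.
move=> t t1; have [E UE El] := HK _ t1.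
exists E, (- ('i%C * t%:C) *: A + E); split => //.
  by apply: le_trans El _; rewrite ler_wpM2r ?sqr_ge0 // lerDl l1norm_ge0.
apply: le_trans (l1normD _ _) _; rewrite l1normZ normc_it mulrDl addrC mulrC.
rewrite [leLHS]addrC [l1norm A * _]mulrC [X in X <= _]addrC lerD //.
apply: le_trans El _; rewrite ler_wpM2l // -real_normK ?num_real // expr2.
by rewrite ler_piMl.
Qed.

(** Write each exponential as 1 + X. The identities drop out of the commutator, leaving [X,Y], whose
    leading part is z^2 [A,B] with z = -it. In the product difference the first-order terms cancel,
    leaving order t^2. *)
Lemma trotter_local A B : dag A = A -> dag B = B -> exists2 K : R, 0 <= K &
  forall t : R, `|t| <= 1 ->
   (exists2 E, comm (ugroup A t) (ugroup B t) = (- t ^+ 2)%:C *: comm A B + E &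
      l1norm E <= K * (`|t| * t ^+ 2)) /\
   l1norm (ugroup A t *m ugroup B t - ugroup (A + B) t) <= K * t ^+ 2.
Proof.
move=> hA hB; have hAB : dag (A + B) = A + B by rewrite dagD hA hB.
have [KA KA0 HA] := ugroup_first_order hA.
have [KB KB0 HB] := ugroup_first_order hB.
have [K K0 HK] := ugroup_first_order hAB.
have a0 := l1norm_ge0 A.
pose K1 := 2 * KA * KB + 2 * l1norm A * KB.
pose K2 := KA + KB + K + KA * KB.
have K10 : 0 <= K1 by rewrite addr_ge0 // !mulr_ge0.
have K20 : 0 <= K2 by rewrite !addr_ge0 // mulr_ge0.
exists (K1 + K2); first exact: addr_ge0.
move=> t t1.
have [E [X [-> XE El Xl]]] := HA _ t1.
have [F [Y [-> YF Fl Yl]]] := HB _ t1.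
have [G [Z [-> ZG Gl Zl]]] := HK _ t1.
set z := - ('i%C * t%:C) in XE YF ZG.
have tt : t ^+ 2 = `|t| * `|t| by rewrite -real_normK ?num_real // expr2.
split.
  exists (comm E Y + comm (z *: A) F).
    have zz : z * z = (- t ^+ 2)%:C.
      by rewrite /z; simpc; congr Complex; ring.
    have Q : comm (z *: A) Y = (- t ^+ 2)%:C *: comm A B + comm (z *: A) F.
      by rewrite YF commDr [comm (z *: A) (z *: B)]commZl commZr scalerA zz.
    rewrite commDl comm1l commDr comm1r !add0r.
    have -> : comm X Y = comm E Y + comm (z *: A) Y by rewrite addrC XE commDl.
    by rewrite Q addrCA.
  apply: le_trans (l1normD _ _) _.
  apply: (@le_trans _ _ (K1 * (`|t| * t ^+ 2))); last first.
    by rewrite ler_wpM2r ?lerDl // mulr_ge0 ?sqr_ge0.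
  rewrite mulrDl; apply: lerD; apply: le_trans (l1norm_comm _ _) _.
    rewrite [leRHS](_ : _ = 2 * (KA * t ^+ 2) * (KB * `|t|)); last by ring.
    by rewrite ler_pM ?mulr_ge0 ?l1norm_ge0 // ler_wpM2l.
  rewrite l1normZ normc_it.
  rewrite [leRHS](_ : _ = 2 * (`|t| * l1norm A) * (KB * t ^+ 2)); last by ring.
  by rewrite ler_wpM2l // !mulr_ge0.
have -> : (1%:M + X) *m (1%:M + Y) - (1%:M + Z) = E + F - G + X *m Y.
  rewrite mulmxDl mul1mx mulmxDr mulmx1; move: (X *m Y) => P.
  rewrite XE YF ZG; move: (1%:M : 'M[R[i]]_n) => I.
  by apply/matrixP => i j; rewrite !mxE; ring.
apply: (@le_trans _ _ (K2 * t ^+ 2)); last by rewrite ler_wpM2r ?lerDr ?sqr_ge0.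
rewrite !mulrDl; apply: le_trans (l1normD _ _) _; apply: lerD.
  apply: le_trans (l1normD _ _) _; apply: lerD; last by rewrite l1normN.
  by apply: le_trans (l1normD _ _) _; apply: lerD.
apply: le_trans (l1normM _ _) _.
rewrite tt [leRHS](_ : _ = (KA * `|t|) * (KB * `|t|)); last by ring.
by rewrite ler_pM ?l1norm_ge0.
Qed.

Lemma le_of_div_nat (x y z s : R) : 0 <= s ->
  (forall m : nat, s <= m.+1%:R -> x <= y + z / m.+1%:R) -> x <= y.
Proof.
move=> s0 H; apply/ler_addgt0Pr => e e0.
(* Beyond [b] both requirements hold: the hypothesis applies, and the error term is at most [e]. *)
pose b := s + `|z| / e.
have b0 : 0 <= b by rewrite addr_ge0 // divr_ge0 // ltW.
have bm : b <= (Num.bound b).+1%:R.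
  by rewrite ltW // (lt_le_trans (archi_boundP b0)) // ler_nat.
apply: (le_trans (H (Num.bound b) _)).
  by apply: le_trans bm; rewrite lerDl divr_ge0 // ltW.
rewrite lerD2l ler_pdivrMr ?ltr0n // (le_trans (ler_norm z)) //.
rewrite mulrC -ler_pdivrMr //; apply: le_trans bm; by rewrite lerDr.
Qed.

Lemma trotter2 (N : 'M[R[i]]_n) mu A B c t : dag A = A -> dag B = B ->
  N *m A = A *m N -> N *m B = B *m N -> 0 <= c ->
  sector_bound N mu (comm A B) c ->
  sector_bound N mu (ugroup A t *m ugroup B t - ugroup (A + B) t) (t ^+ 2 / 2 * c).
Proof.
move=> hA hB NA NB c0 AB.
have hAB : dag (A + B) = A + B by rewrite dagD hA hB.
have NAB : N *m (A + B) = (A + B) *m N by rewrite mulmxDl mulmxDr NA NB.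
have [K K0 HK] := trotter_local hA hB.
move=> psi phi hpsi hphi.
apply: (@le_of_div_nat _ _ (K * (`|t| * t ^+ 2) + K * t ^+ 2) `|t|) => // m tm.
set M : R := m.+1%:R in tm *; have M0 : 0 < M by rewrite ltr0n.
have Mn0 : M != 0 by rewrite gt_eqF.
(* The time step. The side condition |t| <= M gives |d| <= 1, the range in which the local estimates
   hold. *)
pose d := t / M.
have td : t = M * d by rewrite /d mulrCA divff ?mulr1.
have d1 : `|d| <= 1 by rewrite normrM normfV (gtr0_norm M0) ler_pdivrMr // mul1r.
have [[E EE El] Wl] := HK _ d1.
have sA := ugroup_symmetry d hA NA; have sB := ugroup_symmetry d hB NB.
have sAB := ugroup_symmetry d hAB NAB.
have cb : sector_bound N mu (comm (ugroup A d) (ugroup B d))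
    (d ^+ 2 * c + K * (`|d| * d ^+ 2)).
  rewrite EE; apply: sector_boundD.
    have := sector_boundZ (- d ^+ 2)%:C AB.
    by rewrite normcR normrN ger0_norm ?sqr_ge0.
  exact: sector_bound_le El (@sector_bound_l1norm _ _ _ _ _).
have db := sector_bound_le Wl (@sector_bound_l1norm _ _ N mu _).
have e X : dag X = X -> ugroup X d ^+ m.+1 = ugroup X t.
  by move=> hX; rewrite -(ugroup_expn d m.+1 hX) -/M -td.
rewrite -(e _ hA) -(e _ hB) -(e _ hAB).
apply: le_trans (sector_bound_trotter_pow m.+1 sA sB sAB cb db hpsi hphi) _.
(* This is the source of the factor 1/2: M^2/2 times d^2 is t^2/2, while every remainder is of order
   1/M. *)
have bin : 'C(m.+1, 2)%:R <= M ^+ 2 / 2.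
  rewrite ler_pdivlMr // -natrM -natrX ler_nat muln2 bin2 halfK.
  by apply: leq_trans (leq_subr _ _) _; rewrite /= expnS expn1 leq_mul2l leqnSn orbT.
apply: (@le_trans _ _
   (M ^+ 2 / 2 * (d ^+ 2 * c + K * (`|d| * d ^+ 2)) + M * (K * d ^+ 2))).
  have sq : 0 <= d ^+ 2 by exact: sqr_ge0.
  have ad : 0 <= `|d| * d ^+ 2 := mulr_ge0 (normr_ge0 d) sq.
  by rewrite lerD2r ler_wpM2r // (addr_ge0 (mulr_ge0 sq c0) (mulr_ge0 K0 ad)).
have dM : `|d| = `|t| / M by rewrite normrM normfV (gtr0_norm M0).
rewrite dM [X in _ <= _ + X](_ : _ =
   K * (`|t| / M * t ^+ 2) + K * t ^+ 2 / M); last by field.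
rewrite (_ : _ + _ = t ^+ 2 / 2 * c +
   (K * (`|t| / M * t ^+ 2) / 2 + K * t ^+ 2 / M)); last first.
  by rewrite /d; field.
rewrite lerD2l lerD2r ler_pdivrMr // ler_peMr ?ler1n //.
have sq : 0 <= t ^+ 2 by exact: sqr_ge0.
have tM : 0 <= `|t| / M by rewrite divr_ge0 // ltW.
by rewrite (mulr_ge0 K0 (mulr_ge0 tM sq)).
Qed.

(** Split off the first factor: [trotter2] compares it with the sum [S] of all later terms, whose
    commutator bound is the row of [c] at 0. The induction hypothesis handles the rest, multiplied
    on the left by a unitary. *)
Lemma trotter_prod (N : 'M[R[i]]_n) mu (t : R) m (H : 'I_m -> 'M[R[i]]_n)
    (c : 'I_m -> 'I_m -> R) :
  (forall g, dag (H g) = H g) -> (forall g, N *m H g = H g *m N) ->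
  (forall g g', 0 <= c g g') ->
  (forall g g' : 'I_m, (g < g')%N -> sector_bound N mu (comm (H g) (H g')) (c g g')) ->
  sector_bound N mu (\prod_(g < m) ugroup (H g) t - ugroup (\sum_(g < m) H g) t)
    (t ^+ 2 / 2 * \sum_(g < m) \sum_(g' < m | (g < g')%N) c g g').
Proof.
elim: m H c => [|m IH] H c hH NH c0 Hc.
  have -> : ugroup (\sum_(g < 0) H g) t = 1%:M.
    rewrite -(ugroup0 (@dag0 R n n)) big_ord0; congr expmx.
    by apply/matrixP => i j; rewrite !mxE !mulr0.
  by rewrite !big_ord0 mulr0 subrr; exact: sector_bound0.
pose S := \sum_(g < m) H (lift ord0 g).
pose V := \prod_(g < m) ugroup (H (lift ord0 g)) t.
have -> : \prod_(g < m.+1) ugroup (H g) t = ugroup (H ord0) t *m V := big_ord_recl _ _.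
have -> : \sum_(g < m.+1) H g = H ord0 + S := big_ord_recl _ _.
have hS : dag S = S by rewrite dag_sum; apply: eq_bigr => g _; exact: hH.
have NS : N *m S = S *m N.
  by rewrite mulmx_sumr mulmx_suml; apply: eq_bigr => g _; exact: NH.
rewrite (sub_chain _ (ugroup (H ord0) t *m ugroup S t)) -mulmxBr.
rewrite big_ord_recl mulrDr addrC; apply: sector_boundD.
  apply: (trotter2 t (hH ord0) hS (NH ord0) NS); first exact: sumr_ge0.
  rewrite comm_sumr [X in sector_bound _ _ _ X]big_mkcond.
  rewrite [X in sector_bound _ _ _ X]big_ord_recl /= add0r.
  by apply: sector_bound_sum => g _; exact: Hc.
have := IH (fun g => H (lift ord0 g)) (fun g g' => c (lift ord0 g) (lift ord0 g'))
  (fun g => hH _) (fun g => NH _) (fun g g' => c0 _ _)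
  (fun g g' gg' => Hc (lift ord0 g) (lift ord0 g') gg').
move=> /(sector_bound_mull (ugroup_symmetry t (hH ord0) (NH ord0))).
apply: sector_bound_le; rewrite le_eqVlt; apply/orP; left; apply/eqP.
congr (_ * _); apply: eq_bigr => g _.
by rewrite [RHS]big_mkcond big_ord_recl /= add0r big_mkcond.
Qed.

End Trotter.

(** * Canonical anticommutation relations and second quantization *)

Section Fermions.
Variables (R : realType) (F : finType).
Notation fmx := 'M[R[i]]_(#|{: {set F}}|).
Implicit Types (m n p q : F) (S T : {set F}) (X Y : fmx).

Definition jw m S : R[i] :=
  (-1) ^+ #|[set m' in S | (enum_rank m' < enum_rank m)%N]|.

(* [Defs.ann R x s] is [fann R (x, s)] by definition. *)
Definition fann m : fmx :=
  \matrix_(i, j)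
    let S : {set F} := enum_val i in
    let T : {set F} := enum_val j in
    if (m \in T) && (S == T :\ m)
    then (-1) ^+ #|[set m' in T | (enum_rank m' < enum_rank m)%N]| else 0.

Definition fcre m : fmx := dag (fann m).

(** Entries indexed by occupied sets instead of ordinals. *)
Definition ent X S T : R[i] := X (enum_rank S) (enum_rank T).

Lemma ent_eq X Y : (forall S T, ent X S T = ent Y S T) -> X = Y.
Proof.
move=> XY; apply/matrixP => i j.
by have := XY (enum_val i) (enum_val j); rewrite /ent !enum_valK.
Qed.

Lemma big_fock (V : nmodType) (G : 'I_(#|{: {set F}}|) -> V) :
  \sum_i G i = \sum_S G (enum_rank S).
Proof.
rewrite (reindex (@enum_rank {set F})) //=.
by exists enum_val => x _; rewrite ?enum_rankK ?enum_valK.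
Qed.

Lemma entM X Y S T : ent (X *m Y) S T = \sum_U ent X S U * ent Y U T.
Proof. by rewrite /ent mxE big_fock. Qed.

Lemma entD X Y S T : ent (X + Y) S T = ent X S T + ent Y S T.
Proof. by rewrite /ent mxE. Qed.

Lemma entZ a X S T : ent (a *: X) S T = a * ent X S T.
Proof. by rewrite /ent mxE. Qed.

Lemma ent_sum (I : Type) (r : seq I) (P : pred I) (G : I -> fmx) S T :
  ent (\sum_(i <- r | P i) G i) S T = \sum_(i <- r | P i) ent (G i) S T.
Proof. by rewrite /ent summxE. Qed.

Lemma ent1 S T : ent 1%:M S T = (S == T)%:R.
Proof. by rewrite /ent mxE (inj_eq enum_rank_inj). Qed.

Lemma jw_sq m S : jw m S * jw m S = 1.
Proof. by rewrite -expr2 /jw sqrr_sign. Qed.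

Lemma jwU m n S : n \notin S ->
  jw m (n |: S) = (-1) ^+ (enum_rank n < enum_rank m)%N * jw m S.
Proof.
move=> nS; rewrite /jw -exprD; congr (_ ^+ _).
case: (boolP (enum_rank n < enum_rank m)%N) => nm.
  rewrite (_ : [set _ in _ | _] = n |: [set m' in S | (enum_rank m' < enum_rank m)%N]).
    by rewrite cardsU1 !inE (negPf nS).
  apply/setP => k; rewrite !inE; case: eqP => // ->.
  by rewrite nm.
rewrite add0n; apply: eq_card => k; rewrite !inE.
by case: eqP => // ->; rewrite (negPf nm) !andbF.
Qed.

(** The sign counts strictly earlier modes, so a mode never counts itself. *)
Lemma jw_self m S : jw m (m |: S) = jw m S.
Proof.
case: (boolP (m \in S)) => mS.
  have /setUidPr -> // : [set m] \subset S by rewrite sub1set.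
by rewrite jwU // ltnn mul1r.
Qed.

Lemma jwD1 m S : jw m (S :\ m) = jw m S.
Proof.
case: (boolP (m \in S)) => mS; first by rewrite -jw_self setD1K.
congr (jw _ _); apply/setP => k; rewrite !inE.
by case: eqP => // ->; rewrite (negPf mS).
Qed.

(** Only one intermediate set contributes. The right factor [X] lets words in the operators be
    evaluated one letter at a time. *)
Lemma ent_fann m X S T :
  ent (fann m *m X) S T = if m \in S then 0 else jw m S * ent X (m |: S) T.
Proof.
rewrite entM (bigD1 (m |: S)) //= big1 => [|U US].
  rewrite addr0 /ent mxE /= !enum_rankK setU11 /=.
  case: ifPn => [/eqP E|SE].
    have mS : m \notin S by rewrite E !inE eqxx.
    by rewrite (negPf mS) -[X in X * _]/(jw m (m |: S)) jw_self.
  case: (boolP (m \in S)) => [_|mS]; first by rewrite mul0r.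
  by case/eqP: SE; rewrite setU1K.
rewrite /ent mxE /= !enum_rankK.
case: ifPn => [/andP[mU /eqP E]|_]; last by rewrite mul0r.
by case/eqP: US; rewrite E setD1K.
Qed.

Lemma ent_fcre m X S T :
  ent (fcre m *m X) S T = if m \in S then jw m S * ent X (S :\ m) T else 0.
Proof.
have conj_jw U : (jw m U)^*%C = jw m U by rewrite /jw rmorphXn rmorphN1.
rewrite entM (bigD1 (S :\ m)) //= big1 => [|U US].
  rewrite addr0 /ent /fcre !mxE /= !enum_rankK eqxx andbT.
  by case: ifP => _; rewrite ?rmorph0 ?mul0r // -[X in (X)^*%C]/(jw m S) conj_jw.
rewrite /ent /fcre !mxE /= !enum_rankK.
case: ifPn => [/andP[mU /eqP E]|_]; last by rewrite rmorph0 mul0r.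
by case/eqP: US; rewrite E.
Qed.

Lemma ent_hop m n X S T : m != n ->
  ent (fcre m *m (fann n *m X)) S T =
  if (m \in S) && (n \notin S) then jw m S * jw n (S :\ m) * ent X (n |: S :\ m) T
  else 0.
Proof.
move=> mn; rewrite ent_fcre ent_fann !inE eq_sym mn /=.
by case: (m \in S) => //=; case: (n \in S); rewrite ?mulr0 // mulrA.
Qed.

Lemma ent_occ m X S T :
  ent (fcre m *m (fann m *m X)) S T = if m \in S then ent X S T else 0.
Proof.
rewrite ent_fcre ent_fann !inE eqxx /=.
by case: (boolP (m \in S)) => // mS; rewrite jwD1 mulrA jw_sq mul1r setD1K.
Qed.

(** Exactly one of the two modes precedes the other; every anticommutation sign below comes from
    this. *)
Lemma rank_sign m n : m != n ->
  (-1) ^+ (enum_rank m < enum_rank n)%N *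
  (-1) ^+ (enum_rank n < enum_rank m)%N = -1 :> R[i].
Proof.
move=> mn; case: ltngtP => [_|_|/val_inj/enum_rank_inj E]; rewrite ?mulr1 ?mul1r //.
by rewrite E eqxx in mn.
Qed.

Lemma car_mixed m n : fann n *m fcre m = (m == n)%:R *: 1%:M - fcre m *m fann n.
Proof.
apply: ent_eq => S T.
rewrite -[fann n *m _]mulmx1 -[fcre m *m fann n]mulmx1 -scaleN1r entD !entZ -!mulmxA.
rewrite ent_fann ent_fcre !inE.
have [<-|mn] := eqVneq m n.
  rewrite ent_occ ?eqxx /= mul1r mulN1r; case: (boolP (m \in S)) => mS.
    by rewrite subrr.
  by rewrite subr0 jw_self mulrA jw_sq mul1r setU1K.
rewrite ent_hop // mul0r add0r /=.
case: (boolP (m \in S)) => mS; case: (boolP (n \in S)) => nS /=; rewrite ?mulr0 //.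
have -> : (n |: S) :\ m = n |: S :\ m.
  apply/setP => k; rewrite !inE.
  by have [->|//] := eqVneq k n; rewrite eq_sym mn.
(* Removing [m] changes the count for [n] exactly when [m] comes earlier. *)
have jn : jw n S = (-1) ^+ (enum_rank m < enum_rank n)%N * jw n (S :\ m).
  by rewrite -{1}(setD1K mS) jwU // !inE eqxx.
rewrite jn (jwU _ nS); move: (ent _ _ _) (rank_sign mn) => e ab.
transitivity ((-1) ^+ (enum_rank m < enum_rank n)%N *
   (-1) ^+ (enum_rank n < enum_rank m)%N
   * (jw m S * jw n (S :\ m) * e)); first by ring.
by rewrite ab; ring.
Qed.

Lemma car_ann m n : fann m *m fann n = - (fann n *m fann m).
Proof.
apply: ent_eq => S T.
rewrite -[fann m *m _]mulmx1 -[fann n *m fann m]mulmx1 -scaleN1r entZ -!mulmxA.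
rewrite !ent_fann !inE.
have [<-|mn] := eqVneq m n.
  by rewrite ?eqxx /=; case: ifP; rewrite ?mulr0.
rewrite ?(eq_sym n m) ?(negPf mn) /=.
case: (boolP (m \in S)) => mS; case: (boolP (n \in S)) => nS /=; rewrite ?mulr0 //.
rewrite (jwU _ mS) (jwU _ nS) setUCA; move: (ent _ _ _) (rank_sign mn) => e ab.
have sq : (-1) ^+ (enum_rank n < enum_rank m)%N *
    (-1) ^+ (enum_rank n < enum_rank m)%N = 1 :> R[i].
  by rewrite -expr2 sqrr_sign.
move: ab sq; set a := (-1) ^+ _; set b := (-1) ^+ _ => ab bb.
have -> : a = - b by rewrite -[a]mulr1 -bb mulrA ab mulN1r.
ring.
Qed.

Lemma car_cre m n : fcre m *m fcre n = - (fcre n *m fcre m).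
Proof.
rewrite -!dagM car_ann; apply/matrixP => i j; rewrite !mxE rmorphN.
by congr (- _); rewrite !mxE.
Qed.

Definition hopm m n : fmx := fcre m *m fann n.

(** Reordering with [car_mixed] leaves two quartic terms, equal because swapping both creators and
    both annihilators costs two signs. Only the contractions survive. *)
Lemma hopm_comm m n p q :
  comm (hopm m n) (hopm p q) = (p == n)%:R *: hopm m q - (m == q)%:R *: hopm p n.
Proof.
rewrite /comm /hopm !mulmxA -[fcre m *m fann n *m fcre p]mulmxA car_mixed.
rewrite mulmxBr mulmxBl -[fcre p *m fann q *m fcre m]mulmxA car_mixed.
rewrite mulmxBr mulmxBl -!scalemxAr -!scalemxAl !mulmx1.
have -> : fcre m *m (fcre p *m fann n) *m fann q =
    fcre p *m (fcre m *m fann q) *m fann n.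
  rewrite [in LHS]mulmxA car_cre -!mulmxA car_ann.
  by rewrite !mulNmx !mulmxN opprK !mulmxA.
set x := _ *: _; set y := _ *m fann n; set z := _ *: _.
have H (V : zmodType) (a b c : V) : a - b - (c - b) = a - c.
  by rewrite opprB addrA subrK.
exact: H.
Qed.

Definition dG (k : F -> F -> R) : fmx := \sum_m \sum_n (k m n)%:C *: hopm m n.

Lemma dGB (k l : F -> F -> R) : dG (fun m n => k m n - l m n) = dG k - dG l.
Proof.
rewrite /dG -sumrB; apply: eq_bigr => m _; rewrite -sumrB; apply: eq_bigr => n _.
by rewrite -scalerBl rmorphB.
Qed.

Definition kmul (k l : F -> F -> R) m q : R := \sum_n k m n * l n q.

(** Second quantization is a Lie algebra homomorphism. The two kernels stay separate because
    [dG_bound] wants nonnegative entries. *)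
Lemma dG_comm (k l : F -> F -> R) : comm (dG k) (dG l) = dG (kmul k l) - dG (kmul l k).
Proof.
transitivity (\sum_m \sum_n \sum_p \sum_q (k m n * l p q)%:C *:
   ((p == n)%:R *: hopm m q - (m == q)%:R *: hopm p n)).
  rewrite comm_suml; apply: eq_bigr => m _.
  rewrite comm_suml; apply: eq_bigr => n _.
  rewrite comm_sumr; apply: eq_bigr => p _.
  rewrite comm_sumr; apply: eq_bigr => q _.
  by rewrite commZl commZr scalerA hopm_comm rmorphM.
have E1 : dG (kmul k l) = \sum_m \sum_n \sum_p \sum_q
    (k m n * l p q)%:C *: ((p == n)%:R *: hopm m q).
  apply: eq_bigr => m _.
  transitivity (\sum_n \sum_q (k m n * l n q)%:C *: hopm m q).
    rewrite exchange_big; apply: eq_bigr => q _.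
    by rewrite -scaler_suml rmorph_sum.
  apply: eq_bigr => n _; rewrite [RHS](bigD1 n) //= [X in _ = _ + X]big1 => [|p pn].
    by rewrite addr0; apply: eq_bigr => q _; rewrite eqxx scale1r.
  by rewrite big1 // => q _; rewrite (negPf pn) scale0r scaler0.
have E2 : dG (kmul l k) = \sum_m \sum_n \sum_p \sum_q
    (k m n * l p q)%:C *: ((m == q)%:R *: hopm p n).
  transitivity (\sum_p \sum_n \sum_m (l p m * k m n)%:C *: hopm p n).
    apply: eq_bigr => p _; apply: eq_bigr => n _.
    by rewrite -scaler_suml rmorph_sum.
  rewrite exchange_big [RHS]exchange_big; apply: eq_bigr => n _.
  rewrite exchange_big; apply: eq_bigr => m _; apply: eq_bigr => p _.
  rewrite [RHS](bigD1 m) //= [X in _ = _ + X]big1 => [|q qm].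
    by rewrite addr0 eqxx scale1r mulrC.
  by rewrite eq_sym (negPf qm) scale0r scaler0.
rewrite E1 E2 -sumrB; apply: eq_bigr => m _; rewrite -sumrB; apply: eq_bigr => n _.
rewrite -sumrB; apply: eq_bigr => p _; rewrite -sumrB; apply: eq_bigr => q _.
by rewrite scalerBr.
Qed.

End Fermions.

(** * Schur tests in Fock space *)

Section FermionBounds.
Variables (R : realType) (F : finType) (eta : nat).
Notation fmx := 'M[R[i]]_(#|{: {set F}}|).
Notation fvec := 'cV[R[i]]_(#|{: {set F}}|).
Implicit Types (m n p q : F) (S T : {set F}) (X Y : fmx) (psi phi : fvec).

Definition numop : fmx := \sum_m hopm R m m.

Definition setdiag (v : {set F} -> R) : fmx := diag_mx (\row_i (v (enum_val i))%:C).

Lemma ent_setdiag v S T : ent (setdiag v) S T = if S == T then (v S)%:C else 0.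
Proof.
rewrite /ent !mxE enum_rankK (inj_eq enum_rank_inj).
by case: eqP => [->|_]; rewrite ?mulr1n ?mulr0n.
Qed.

Lemma hopm_diag m : hopm R m m = setdiag (fun S => (m \in S)%:R).
Proof.
apply: ent_eq => S T.
rewrite ent_setdiag -[hopm R m m]mulmx1 /hopm -mulmxA ent_occ ent1.
by case: (m \in S); case: (S == T); rewrite ?rmorph0 ?rmorph1.
Qed.

Lemma setdiagD v w : setdiag v + setdiag w = setdiag (fun S => v S + w S).
Proof.
by apply: ent_eq => S T; rewrite entD !ent_setdiag; case: eqP; rewrite ?addr0 ?rmorphD.
Qed.

Lemma setdiagZ a v : a%:C *: setdiag v = setdiag (fun S => a * v S).
Proof.
by apply: ent_eq => S T; rewrite entZ !ent_setdiag; case: eqP; rewrite ?mulr0 ?rmorphM.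
Qed.

Lemma setdiag_sum (I : Type) (r : seq I) (P : pred I) (v : I -> {set F} -> R) :
  \sum_(i <- r | P i) setdiag (v i) = setdiag (fun S => \sum_(i <- r | P i) v i S).
Proof.
apply: ent_eq => S T; rewrite ent_sum ent_setdiag.
under eq_bigr do rewrite ent_setdiag.
by case: eqP => _; rewrite ?rmorph_sum // big1.
Qed.

Lemma ent_setdiag_mull v X S T : ent (setdiag v *m X) S T = (v S)%:C * ent X S T.
Proof. by rewrite /ent mul_diag_mx !mxE enum_rankK. Qed.

Lemma ent_setdiag_mulr v X S T : ent (X *m setdiag v) S T = ent X S T * (v T)%:C.
Proof. by rewrite /ent mul_mx_diag !mxE enum_rankK. Qed.

Lemma setdiagM v w : setdiag v *m setdiag w = setdiag (fun S => v S * w S).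
Proof.
apply: ent_eq => S T; rewrite ent_setdiag_mull !ent_setdiag.
case: eqP => _; last by rewrite mulr0.
exact: esym (rmorphM (real_complex R) _ _).
Qed.

Lemma dag_setdiag v : dag (setdiag v) = setdiag v.
Proof.
rewrite /setdiag dag_diag; congr diag_mx; apply/rowP => j.
by rewrite !mxE conjc_real.
Qed.

Lemma ent_comm_setdiag X v S T :
  ent (comm X (setdiag v)) S T = ent X S T * (v T - v S)%:C.
Proof.
rewrite /comm -scaleN1r entD entZ ent_setdiag_mulr ent_setdiag_mull rmorphB; ring.
Qed.

Lemma numop_diag : numop = setdiag (fun S => #|S|%:R).
Proof.
rewrite /numop; under eq_bigr do rewrite hopm_diag.
rewrite setdiag_sum; congr setdiag; apply/funext => S.
rewrite -natr_sum -sum1_card [in RHS]big_mkcond.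
by congr _%:R; apply: eq_bigr => m _; case: (m \in S).
Qed.

(** The number operator is diagonal with eigenvalue the cardinality, so an eigenvector lives on a
    single cardinality. *)
Lemma state_support psi S : sector_state numop eta%:R psi -> #|S| != eta ->
  psi (enum_rank S) 0 = 0.
Proof.
move=> [_ H] Se; have /matrixP/(_ (enum_rank S) 0) := H.
rewrite numop_diag mul_diag_mx !mxE enum_rankK rmorph_nat => /eqP.
rewrite -subr_eq0 -mulrBl mulf_eq0 => /orP[|/eqP//].
by rewrite subr_eq0 eqr_nat (negPf Se).
Qed.

Lemma normc_dot (u w : fvec) : normc ((dag u *m w) 0 0) <=
  (\sum_i normc (u i 0) ^+ 2 + \sum_i normc (w i 0) ^+ 2) / 2.
Proof.
rewrite mxE -big_split /= mulr_suml; apply: le_trans (normc_sum _ _ _) _.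
apply: ler_sum => i _; rewrite Normc.normcM mxE.
rewrite normc_conj.
move: (normc (u i 0)) (normc (w i 0)) => a b.
have := sqr_ge0 (a - b); rewrite ler_pdivlMr //; nra.
Qed.

Lemma dag_dot (u : fvec) : (dag u *m u) 0 0 = (\sum_i normc (u i 0) ^+ 2)%:C.
Proof.
rewrite mxE rmorph_sum; apply: eq_bigr => i _.
by rewrite mxE mulrC rmorphXn -sqr_normc.
Qed.

(** The left side is the expectation of the number operator in [psi]. *)
Lemma sum_fann_norm psi : sector_state numop eta%:R psi ->
  \sum_m \sum_i normc ((fann R m *m psi) i 0) ^+ 2 = eta%:R.
Proof.
move=> [p1 p2]; apply: (@complexI R); rewrite rmorph_sum rmorph_nat.
transitivity ((dag psi *m (numop *m psi)) 0 0).
  rewrite /numop mulmx_suml mulmx_sumr summxE; apply: eq_bigr => m _.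
  by rewrite /= -dag_dot dagM /hopm /fcre !mulmxA.
by rewrite p2 -scalemxAr p1 !mxE eqxx mulr1.
Qed.

(** Each hopping amplitude is the inner product of a_m psi with a_n phi, hence at most half the sum
    of their squared norms. Row sums control the psi part and column sums the phi part; by
    [sum_fann_norm] each contributes eta/2. *)
Lemma dG_bound (k : F -> F -> R) : (forall m n, 0 <= k m n) ->
  (forall m, \sum_n k m n <= 1) -> (forall n, \sum_m k m n <= 1) ->
  sector_bound numop eta%:R (dG k) eta%:R.
Proof.
move=> k0 krow kcol psi phi hpsi hphi.
pose al m := \sum_i normc ((fann R m *m psi) i 0) ^+ 2.
pose be m := \sum_i normc ((fann R m *m phi) i 0) ^+ 2.
have al0 m : 0 <= al m by apply: sumr_ge0 => i _; exact: sqr_ge0.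
have be0 m : 0 <= be m by apply: sumr_ge0 => i _; exact: sqr_ge0.
rewrite /dG mulmx_sumr mulmx_suml summxE; apply: le_trans (normc_sum _ _ _) _.
apply: (@le_trans _ _ (\sum_m \sum_n (k m n * al m + k m n * be n) / 2)).
  apply: ler_sum => m _; rewrite mulmx_sumr mulmx_suml summxE.
  apply: le_trans (normc_sum _ _ _) _; apply: ler_sum => n _.
  rewrite -scalemxAr -scalemxAl mxE Normc.normcM -mulrDr -mulrA.
  rewrite normcR ger0_norm // ler_wpM2l //; apply: le_trans (normc_dot _ _).
  by rewrite dagM /hopm /fcre !mulmxA.
apply: (@le_trans _ _ ((\sum_m al m + \sum_n be n) / 2)); last first.
  rewrite [\sum_m al m](sum_fann_norm hpsi) [\sum_n be n](sum_fann_norm hphi).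
  lra.
under eq_bigr do rewrite -mulr_suml big_split /=.
rewrite -mulr_suml ler_wpM2r ?invr_ge0 // big_split /=; apply: lerD.
  by apply: ler_sum => m _; rewrite -mulr_suml ler_piMl.
rewrite exchange_big /=; apply: ler_sum => n _.
by rewrite -mulr_suml ler_piMl.
Qed.

Lemma schur_bound X c : (forall S T, normc (ent X S T) = normc (ent X T S)) ->
  (forall S, #|S| = eta -> \sum_T normc (ent X S T) <= c) ->
  sector_bound numop eta%:R X c.
Proof.
move=> Xsym Xrow psi phi hpsi hphi.
pose a S := normc (psi (enum_rank S) 0); pose b S := normc (phi (enum_rank S) 0).
have a1 : \sum_S a S ^+ 2 = 1.
  have [/state_normc2 H _] := hpsi.
  by rewrite -[RHS]H (big_fock (fun i => normc (psi i 0) ^+ 2)).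
have b1 : \sum_S b S ^+ 2 = 1.
  have [/state_normc2 H _] := hphi.
  by rewrite -[RHS]H (big_fock (fun i => normc (phi i 0) ^+ 2)).
rewrite -mulmxA mxE big_fock; apply: le_trans (normc_sum _ _ _) _.
apply: (@le_trans _ _ (\sum_S \sum_T
   (normc (ent X S T) * a S ^+ 2 + normc (ent X S T) * b T ^+ 2) / 2)).
  apply: ler_sum => S _.
  rewrite Normc.normcM [dag psi _ _]mxE [(X *m phi) _ _]mxE big_fock.
  rewrite normc_conj -/(a S).
  apply: (@le_trans _ _ (a S * \sum_T normc (ent X S T) * b T)).
    rewrite ler_wpM2l ?normc_ge0 //; apply: le_trans (normc_sum _ _ _) _.
    by apply: ler_sum => T _; rewrite Normc.normcM.
  rewrite mulr_sumr; apply: ler_sum => T _.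
  rewrite mulrCA -mulrDr -mulrA ler_wpM2l ?normc_ge0 //.
  move: (a S) (b T) => x y; have := sqr_ge0 (x - y); rewrite ler_pdivlMr //; nra.
(* Used once for rows with [psi] and once for columns with [phi]; sets of the wrong cardinality
   carry no amplitude, so only rows with [eta] elements matter. *)
have half (f : {set F} -> R) psi' : sector_state numop eta%:R psi' ->
   (forall S, #|S| = eta -> f S <= c) -> \sum_S normc (psi' (enum_rank S) 0) ^+ 2 = 1 ->
   \sum_S f S * normc (psi' (enum_rank S) 0) ^+ 2 <= c.
  move=> hpsi' fc s1; rewrite -[c]mulr1 -s1 mulr_sumr; apply: ler_sum => S _.
  have [Se|Se] := eqVneq #|S| eta; first by rewrite ler_wpM2r ?sqr_ge0 ?fc.
  by rewrite (state_support hpsi' Se) Normc.normc0 expr0n !mulr0.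
under eq_bigr do rewrite -mulr_suml big_split /=.
rewrite -mulr_suml ler_pdivrMr // mulr_natr mulr2n big_split /=; apply: lerD.
  under eq_bigr do rewrite -mulr_suml.
  exact: half.
rewrite exchange_big /=; under eq_bigr do rewrite -mulr_suml.
apply: half => // T Te; under eq_bigr do rewrite Xsym.
exact: Xrow.
Qed.

Lemma dag_hopm m n : dag (hopm R m n) = hopm R n m.
Proof. by rewrite /hopm dagM /fcre dagK. Qed.

Lemma dag_dG (k : F -> F -> R) : (forall m n, k m n = k n m) -> dag (dG k) = dG k.
Proof.
move=> ks; rewrite /dG dag_sum exchange_big; apply: eq_bigr => m _ /=.
rewrite dag_sum; apply: eq_bigr => n _.
by rewrite dagZr dag_hopm ks.
Qed.

Lemma normc_ent_hopm m n S T : m != n -> normc (ent (hopm R m n) S T) =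
  ([&& m \in S, n \notin S & n |: S :\ m == T])%:R.
Proof.
move=> mn; rewrite -[hopm R m n]mulmx1 /hopm -mulmxA ent_hop // ent1.
case: (m \in S); last exact: Normc.normc0.
case: (n \in S); first exact: Normc.normc0.
rewrite /=.
have nj x U : normc (jw R x U) = 1.
  by rewrite /jw -signr_odd; case: odd; rewrite ?expr0 ?expr1 ?normcN Normc.normc1.
rewrite !Normc.normcM !nj !mul1r.
by case: eqP => _; rewrite ?Normc.normc0 ?Normc.normc1.
Qed.

(** An entry of the commutator is a hopping amplitude times the change of [v], so a row sum runs
    over the allowed hops out of [S]. Symmetry of [k] makes the moduli symmetric, as [schur_bound]
    requires. *)
Lemma hop_diag_bound (k : F -> F -> R) v c : (forall m n, k m n = k n m) ->
  (forall m n, 0 <= k m n) -> (forall m, k m m = 0) ->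
  (forall S, #|S| = eta ->
    \sum_m \sum_n k m n *
      (((m \in S) && (n \notin S))%:R * `|v (n |: S :\ m) - v S|) <= c) ->
  sector_bound numop eta%:R (comm (dG k) (setdiag v)) c.
Proof.
move=> ks k0 kd Hc; apply: schur_bound => [S T|S Se].
  rewrite !ent_comm_setdiag !Normc.normcM -[v S - v T]opprB rmorphN normcN.
  by congr (_ * _); rewrite -{1}(dag_dG ks) /ent [dag _ _ _]mxE normc_conj.
apply: le_trans (Hc S Se).
apply: (@le_trans _ _ (\sum_T \sum_m \sum_n k m n *
   ([&& m \in S, n \notin S & n |: S :\ m == T]%:R * `|v T - v S|))).
  apply: ler_sum => T _; rewrite ent_comm_setdiag Normc.normcM normcR.
  under eq_bigr do under eq_bigr do rewrite mulrA.
  under eq_bigr do rewrite -mulr_suml.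
  rewrite -mulr_suml ler_wpM2r // /dG ent_sum; apply: le_trans (normc_sum _ _ _) _.
  apply: ler_sum => m _; rewrite ent_sum; apply: le_trans (normc_sum _ _ _) _.
  apply: ler_sum => n _; rewrite entZ Normc.normcM.
  rewrite normcR ger0_norm //; have [->|mn] := eqVneq m n; first by rewrite kd !mul0r.
  by rewrite normc_ent_hopm.
rewrite exchange_big; apply: ler_sum => m _.
rewrite exchange_big; apply: ler_sum => n _ /=.
rewrite -mulr_sumr ler_wpM2l // (bigD1 (n |: S :\ m)) //= big1 ?addr0 => [|T].
  by rewrite eqxx andbT.
by rewrite eq_sym => /negPf ->; rewrite !andbF mul0r.
Qed.

End FermionBounds.

(** * The lattice Hamiltonian *)

Lemma sum_species (V : nmodType) (G : species -> V) :
  \sum_s G s = G (true, true) + G (true, false) + (G (false, true) + G (false, false)).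
Proof.
have bb (H : bool -> V) : \sum_a H a = H true + H false.
  by rewrite (bigD1 true) //= (big_pred1 false) // => -[].
transitivity (\sum_a \sum_b G (a, b)); last by rewrite !bb.
by rewrite pair_bigA; apply: eq_bigr => -[].
Qed.

Ltac eval_nat :=
  repeat match goal with
  | |- context [divn ?n ?k] =>
      let v := eval vm_compute in (divn n k) in
      change (divn n k) with v
  | |- context [binomial ?n ?k] =>
      let v := eval vm_compute in (binomial n k) in
      change (binomial n k) with v
  end.

(** * On-site energies and the inequality for a single bond *)

Section OnSite.
Variable R : realType.
Implicit Types (o : species -> bool) (C D : R).

Definition nocc o : nat := \sum_s o s.

(** Energy of a site with k nucleons: the prefactors 1/2 and 1/6 turn ordered tuples into unordered
    pairs and triples. *)
Definition onsite C D (k : nat) : R := C * 'C(k, 2)%:R + D * 'C(k, 3)%:R.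

Lemma pair_count o :
  \sum_s \sum_(s' | s != s') ((o s)%:R * (o s')%:R : R) = 2 * 'C(nocc o, 2)%:R.
Proof.
under eq_bigr => s _ do rewrite (big_mkcond (fun s' => s != s')) /=.
rewrite /nocc.
rewrite !sum_species /=.
by case: (o (true, true)); case: (o (true, false)); case: (o (false, true));
  case: (o (false, false));
  eval_nat; rewrite /=; ring.
Qed.

Lemma triple_count o :
  \sum_s \sum_s' \sum_(s'' | [&& s != s', s' != s'' & s != s''])
    ((o s)%:R * (o s')%:R * (o s'')%:R : R) = 6 * 'C(nocc o, 3)%:R.
Proof.
under eq_bigr => s _ do under eq_bigr => s' _ do
  rewrite (big_mkcond (fun s'' => [&& s != s', s' != s'' & s != s''])) /=.
rewrite /nocc.
rewrite !sum_species /=.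
by case: (o (true, true)); case: (o (true, false)); case: (o (false, true));
  case: (o (false, false));
  eval_nat; rewrite /=; ring.
Qed.

(* The combination A1 (k %/ 2) + A2 (k %/ 3) + A3 (k %/ 4) of the theorem. *)
Definition cluster_bound C D (k : nat) : R :=
  2 * `|C| * (k %/ 2)%:R + (2 * `|3 * C + D| + `|D|) * (k %/ 3)%:R
  + (2 * `|6 * C + 4 * D| + 4 * `|D|) * (k %/ 4)%:R.

(** A finite check over the occupations of a bond; [a], [b], [c], [d] replace the absolute values on
    the right so that every case is linear. The coefficients reflect all particles on one site: two
    give 2|C|, three give |6C+3D|, four give |12C+12D|. *)
Lemma bond_bound_aux C D (a b c d : R) (p q r : nat) : (p + q + r <= 4)%N ->
  C <= a -> - C <= a -> 3 * C + D <= b -> - (3 * C + D) <= b ->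
  6 * C + 4 * D <= c -> - (6 * C + 4 * D) <= c -> D <= d -> - D <= d ->
  p%:R * `|onsite C D (p + r).-1 + onsite C D (q + r).+1
           - onsite C D (p + r) - onsite C D (q + r)|
  + q%:R * `|onsite C D (q + r).-1 + onsite C D (p + r).+1
           - onsite C D (p + r) - onsite C D (q + r)|
  <= 2 * a * ((p + r + (q + r)) %/ 2)%:R + (2 * b + d) * ((p + r + (q + r)) %/ 3)%:R
  + (2 * c + 4 * d) * ((p + r + (q + r)) %/ 4)%:R.
Proof.
rewrite /onsite => pqr a1 a2 b1 b2 c1 c2 d1 d2.
have normE (x : R) : `|x| = x \/ `|x| = - x.
  by case: (lerP 0 x) => x0; [left; rewrite ger0_norm | right; rewrite ltr0_norm].
case: p pqr => [|[|[|[|[|p]]]]] //; case: q => [|[|[|[|[|q]]]]] //;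
case: r => [|[|[|[|[|r]]]]] // _; eval_nat; rewrite ?mul0r ?add0r ?addr0.
all: try match goal with |- context [`|?X|] => have [->|->] := normE X end.
all: try match goal with |- context [`|?X|] => have [->|->] := normE X end.
all: try lra.
Qed.

Lemma bond_bound C D (p q r : nat) : (p + q + r <= 4)%N ->
  p%:R * `|onsite C D (p + r).-1 + onsite C D (q + r).+1
           - onsite C D (p + r) - onsite C D (q + r)|
  + q%:R * `|onsite C D (q + r).-1 + onsite C D (p + r).+1
           - onsite C D (p + r) - onsite C D (q + r)|
  <= cluster_bound C D (p + r + (q + r)).
Proof.
by move=> pqr; apply: bond_bound_aux => //; rewrite ?ler_norm // -normrN ler_norm.
Qed.

End OnSite.

Section Lattice.
Variables (R : realType) (L : nat).
Implicit Types (W : {set site L * site L}) (S : {set mode L}).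
Implicit Types (x y z : site L) (C D h : R).

Lemma sum_mode (V : nmodType) (f : mode L -> V) :
  \sum_m f m = \sum_x \sum_s f (x, s).
Proof. by rewrite pair_bigA; apply: eq_bigr => -[]. Qed.

Definition matching W :=
  (forall b, b \in W -> b.1 != b.2) /\
  {in W &, forall b b', b != b' -> [disjoint ends b & ends b']}.

(** Hopping preserves the species. A bond is stored in one orientation, so both are tested to make
    the matrix symmetric. *)
Definition adj W (m n : mode L) : nat :=
  (m.2 == n.2) * (((m.1, n.1) \in W) + ((n.1, m.1) \in W)).

Lemma adj_sym W m n : adj W m n = adj W n m.
Proof. by rewrite /adj eq_sym addnC. Qed.

Lemma matching_degree W x : matching W ->
  (\sum_y (((x, y) \in W) + ((y, x) \in W)) <= 1)%N.
Proof.
move=> [Wne Wdis].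
have uniq b b' : b \in W -> b' \in W -> x \in ends b -> x \in ends b' -> b = b'.
  move=> bW b'W xb xb'; apply/eqP/negPn/negP => bb'.
  by have := disjointFr (Wdis _ _ bW b'W bb') xb; rewrite xb'.
have [/existsP[b /andP[bW xb]]|/existsPn H] :=
  boolP [exists b, (b \in W) && (x \in ends b)].
  (* The partner of [x] in its only bond. If both orientations were in [W], uniqueness would make
     them one pair, hence a loop. *)
  pose y0 := if b.1 == x then b.2 else b.1.
  rewrite (bigD1 y0) //= big1 => [|y yy0].
    rewrite addn0; case: (boolP ((x, y0) \in W)) => // xy;
      case: (boolP ((y0, x) \in W)) => // yx.
    have E := uniq _ _ xy yx; rewrite !inE !eqxx ?orbT in E.
    have [E1 E2] := E isT isT.
    by have := Wne _ xy; rewrite /= E1 eqxx.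
  apply/eqP; rewrite addn_eq0 !eqb0; apply/andP; split; apply/negP => xyW.
    have E := uniq _ _ bW xyW xb; rewrite !inE eqxx in E; have E' := E isT.
    by rewrite /y0 E' /= eqxx eqxx in yy0.
  have E := uniq _ _ bW xyW xb; rewrite !inE eqxx orbT in E; have E' := E isT.
  rewrite /y0 E' /= in yy0; move: yy0; have := Wne _ bW; rewrite E' /=.
  by case: eqP => //; rewrite eqxx.
rewrite big1 // => y _; apply/eqP; rewrite addn_eq0 !eqb0; apply/andP.
by split; [move: (H (x, y))|move: (H (y, x))]; rewrite !inE eqxx ?orbT andbT.
Qed.

Lemma adj_row W m : matching W -> (\sum_n adj W m n <= 1)%N.
Proof.
move=> hW; apply: leq_trans (matching_degree m.1 hW).
have -> : (\sum_n adj W m n = \sum_y \sum_s adj W m (y, s))%N := sum_mode _.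
apply: leq_sum => y _.
rewrite (bigD1 m.2) //= big1 => [|s sm]; first by rewrite /adj eqxx mul1n addn0.
by rewrite /adj eq_sym (negPf sm).
Qed.

(** General in [G]: it serves for operators in [Hhop_dG] and for real numbers in
    [Hhop_onsite_bound]. *)
Lemma adj_sum (V : nmodType) W (G : mode L -> mode L -> V) :
  \sum_m \sum_n G m n *+ adj W m n =
  \sum_(b in W) \sum_s (G (b.1, s) (b.2, s) + G (b.2, s) (b.1, s)).
Proof.
have sumW (H : site L * site L -> V) :
    \sum_(b in W) H b = \sum_x \sum_y H (x, y) *+ ((x, y) \in W).
  rewrite pair_bigA big_mkcond; apply: eq_bigr => -[x y] _ /=.
  by case: ((x, y) \in W).
have row x s : \sum_n G (x, s) n *+ adj W (x, s) n =
    \sum_y (G (x, s) (y, s) *+ ((x, y) \in W) + G (x, s) (y, s) *+ ((y, x) \in W)).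
  rewrite sum_mode.
  apply: eq_bigr => y _; rewrite (bigD1 s) //= big1 => [|s' ss'].
    by rewrite addr0 /adj eqxx mul1n mulrnDr.
  by rewrite /adj eq_sym (negPf ss') mulr0n.
rewrite sum_mode.
rewrite exchange_big [RHS]exchange_big /=; apply: eq_bigr => s _.
rewrite sumW; under eq_bigr do rewrite row big_split /=.
rewrite big_split /= [X in _ + X]exchange_big -big_split; apply: eq_bigr => x _ /=.
by rewrite -big_split; apply: eq_bigr => y _; rewrite mulrnDl.
Qed.

Lemma hop_hopm (b : site L * site L) s :
  hop R b s = hopm R (b.1, s) (b.2, s) + hopm R (b.2, s) (b.1, s).
Proof. by rewrite /hopm /fcre !dagE. Qed.

Lemma occ_hopm x s : occ R x s = hopm R (x, s) (x, s).
Proof. by rewrite /hopm /fcre !dagE. Qed.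

Lemma Ntot_numop : Ntot R L = numop R (mode L).
Proof.
rewrite /Ntot /numop sum_mode.
by apply: eq_bigr => x _; apply: eq_bigr => s _; rewrite occ_hopm.
Qed.

Lemma Hhop_dG h W : Hhop h W =
  (- h)%:C *: dG (fun m n => (adj W m n)%:R) + h%:C *: numop R (mode L).
Proof.
rewrite /Hhop rmorphN; congr (_ *: _ + _ *: _).
  rewrite exchange_big /=.
  under eq_bigr do under eq_bigr do rewrite hop_hopm.
  rewrite -adj_sum; apply: eq_bigr => m _; apply: eq_bigr => n _.
  by rewrite rmorph_nat scaler_nat.
by rewrite exchange_big -Ntot_numop.
Qed.

(** The number operator is the second quantization of the identity kernel, which commutes with every
    kernel. *)
Lemma dG_numop_comm (k : mode L -> mode L -> R) : comm (dG k) (numop R (mode L)) = 0.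
Proof.
have -> : numop R (mode L) = dG (fun m n => (m == n)%:R).
  apply: eq_bigr => m _; rewrite (bigD1 m) //= big1 => [|n nm].
    by rewrite eqxx scale1r addr0.
  by rewrite eq_sym (negPf nm) scale0r.
rewrite dG_comm -dGB /dG big1 // => m _; rewrite big1 // => n _.
rewrite /kmul (bigD1 n) //= big1 => [|p pn]; last by rewrite (negPf pn) mulr0.
rewrite (bigD1 m) //= [X in _ - (_ + X)]big1 => [|p pm].
  by rewrite !eqxx mulr1 mul1r !addr0 subrr scale0r.
by rewrite eq_sym (negPf pm) mul0r.
Qed.

Lemma kmul_adj_bound W W' : matching W -> matching W' -> forall m,
  \sum_n kmul (fun m n => (adj W m n)%:R) (fun m n => (adj W' m n)%:R) m n <= 1 :> R.
Proof.
move=> hW hW' m; rewrite /kmul exchange_big /=.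
apply: (@le_trans _ _ (\sum_p (adj W m p)%:R)).
  apply: ler_sum => p _; rewrite -mulr_sumr ler_piMr // -natr_sum lern1.
  exact: adj_row.
by rewrite -natr_sum lern1 adj_row.
Qed.

(** Both adjacency matrices are symmetric, so transposing their product reverses its factors and
    columns become rows. *)
Lemma kmul_adj_bound_col W W' : matching W -> matching W' -> forall n,
  \sum_m kmul (fun m n => (adj W m n)%:R) (fun m n => (adj W' m n)%:R) m n <= 1 :> R.
Proof.
move=> hW hW' n; apply: le_trans (kmul_adj_bound hW' hW n).
rewrite le_eqVlt; apply/orP; left; apply/eqP; apply: eq_bigr => m _.
by apply: eq_bigr => p _; rewrite mulrC adj_sym [adj W m p]adj_sym.
Qed.

Lemma Hhop_comm_bound eta h W W' : matching W -> matching W' ->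
  sector_bound (numop R (mode L)) eta%:R (comm (Hhop h W) (Hhop h W'))
    (2 * h ^+ 2 * eta%:R).
Proof.
move=> hW hW'; rewrite !Hhop_dG.
set A := dG _; set B := dG _; set N := numop R _.
have AN : comm A N = 0 := dG_numop_comm _.
have NB : comm N B = 0 by rewrite comm_swap dG_numop_comm oppr0.
have NN : comm N N = 0 by rewrite /comm subrr.
have -> : comm ((- h)%:C *: A + h%:C *: N) ((- h)%:C *: B + h%:C *: N) =
    (h ^+ 2)%:C *: comm A B.
  rewrite commDl !commDr !commZl !commZr AN NB NN !scaler0 !addr0 scalerA.
  by rewrite -rmorphM mulrNN expr2.
rewrite /A /B dG_comm scalerBr.
have k0 U U' m n :
    0 <= kmul (fun m n => (adj U m n)%:R) (fun m n => (adj U' m n)%:R) m n :> R.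
  by apply: sumr_ge0 => p _; rewrite mulr_ge0.
have bd U U' : matching U -> matching U' -> sector_bound N eta%:R
    (dG (kmul (fun m n => (adj U m n)%:R) (fun m n => (adj U' m n)%:R))) eta%:R.
  move=> hU hU'.
  exact: (@dG_bound R _ eta _ (k0 U U') (kmul_adj_bound hU hU')
    (kmul_adj_bound_col hU hU')).
have n2 : normc (h ^+ 2)%:C = h ^+ 2 
  by rewrite normcR ger0_norm ?sqr_ge0.
rewrite (_ : 2 * h ^+ 2 * eta%:R = h ^+ 2 * eta%:R + h ^+ 2 * eta%:R); last by ring.
apply: sector_boundD; last apply: sector_boundN.
  by have := sector_boundZ (h ^+ 2)%:C (bd _ _ hW hW'); rewrite n2.
by have := sector_boundZ (h ^+ 2)%:C (bd _ _ hW' hW); rewrite n2.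
Qed.

Definition nsite S x : nat := nocc (fun s => (x, s) \in S).

Definition onsite_energy C D S : R := \sum_x onsite C D (nsite S x).

Lemma HC_HD_diag C D :
  HC L C + HD L D = setdiag (onsite_energy C D) :> fockop R L.
Proof.
have occE x s : occ R x s = setdiag (fun S => ((x, s) \in S)%:R).
  by rewrite occ_hopm hopm_diag.
have E1 : HC L C = setdiag (fun S => \sum_x C * 'C(nsite S x, 2)%:R) :> fockop R L.
  rewrite /HC; under eq_bigr do under eq_bigr do under eq_bigr do
    rewrite !occE setdiagM.
  under eq_bigr do under eq_bigr do rewrite setdiag_sum.
  under eq_bigr do rewrite setdiag_sum.
  rewrite setdiag_sum setdiagZ; congr setdiag; apply/funext => S.
  rewrite mulr_sumr; apply: eq_bigr => x _.
  by rewrite pair_count mulrA divfK // pnatr_eq0.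
have E2 : HD L D = setdiag (fun S => \sum_x D * 'C(nsite S x, 3)%:R) :> fockop R L.
  rewrite /HD; under eq_bigr do under eq_bigr do under eq_bigr do
    under eq_bigr do rewrite !occE !setdiagM.
  under eq_bigr do under eq_bigr do under eq_bigr do rewrite setdiag_sum.
  under eq_bigr do under eq_bigr do rewrite setdiag_sum.
  under eq_bigr do rewrite setdiag_sum.
  rewrite setdiag_sum setdiagZ; congr setdiag; apply/funext => S.
  rewrite mulr_sumr; apply: eq_bigr => x _.
  by rewrite triple_count mulrA divfK // pnatr_eq0.
have -> : HC L C + HD L D = setdiag (fun S => \sum_x C * 'C(nsite S x, 2)%:R)
    + setdiag (fun S => \sum_x D * 'C(nsite S x, 3)%:R) :> fockop R L.
  by rewrite -E1 -E2.
rewrite setdiagD; congr setdiag; apply/funext => S.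
by rewrite -big_split.
Qed.

Lemma nsite_hop S x y s z : x != y -> (x, s) \in S -> (y, s) \notin S ->
  nsite ((y, s) |: S :\ (x, s)) z =
  if z == x then (nsite S x).-1 else if z == y then (nsite S y).+1 else nsite S z.
Proof.
move=> xy xS yS; rewrite /nsite /nocc.
have [->|zx] := eqVneq z x.
  rewrite (bigD1 s) //= [in RHS](bigD1 s) //= xS !inE !xpair_eqE eqxx (negPf xy) /=.
  rewrite ?eqxx /= !add0n.
  by apply: eq_bigr => s' ss'; rewrite !inE !xpair_eqE (negPf xy) (negPf ss') eqxx.
have [->|zy] := eqVneq z y.
  rewrite (bigD1 s) //= [in RHS](bigD1 s) //= (negPf yS) !inE !xpair_eqE !eqxx /=.
  rewrite add0n add1n; congr _.+1; apply: eq_bigr => s' ss'.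
  by rewrite !inE !xpair_eqE (negPf ss') !eqxx eq_sym (negPf xy).
by apply: eq_bigr => s' _; rewrite !inE !xpair_eqE (negPf zx) (negPf zy).
Qed.

Lemma onsite_energy_hop C D S x y s : x != y -> (x, s) \in S -> (y, s) \notin S ->
  onsite_energy C D ((y, s) |: S :\ (x, s)) - onsite_energy C D S =
  onsite C D (nsite S x).-1 + onsite C D (nsite S y).+1
  - onsite C D (nsite S x) - onsite C D (nsite S y).
Proof.
move=> xy xS yS; have yx : y != x by rewrite eq_sym.
rewrite /onsite_energy -sumrB (bigD1 x) //= (bigD1 y) //= big1 => [|z /andP[zx zy]].
  rewrite !(nsite_hop _ xy xS yS) eqxx (negPf yx) eqxx; ring.
by rewrite (nsite_hop _ xy xS yS) (negPf zx) (negPf zy) subrr.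
Qed.

Lemma card_nsite S : (\sum_x nsite S x)%N = #|S|.
Proof.
rewrite -sum1_card [RHS]big_mkcond /=.
apply: esym; apply: etrans (sum_mode (fun m => if m \in S then 1%N else 0%N)) _.
by apply: eq_bigr => x _; apply: eq_bigr => s _; case: (_ \in S).
Qed.

(** Regrouped by sites, each occupation is weighted by the degree of its site, which is at most 1 in
    a matching. *)
Lemma sum_bonds_nsite W S : matching W ->
  (\sum_(b in W) (nsite S b.1 + nsite S b.2) <= #|S|)%N.
Proof.
move=> hW; rewrite -card_nsite.
have -> : (\sum_(b in W) (nsite S b.1 + nsite S b.2) =
   \sum_x nsite S x * \sum_y (((x, y) \in W) + ((y, x) \in W)))%N.
  transitivity (\sum_x \sum_y (nsite S x + nsite S y) * ((x, y) \in W))%N.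
    rewrite pair_bigA big_mkcond; apply: eq_bigr => -[x y] _ /=.
    by case: ((x, y) \in W); rewrite ?muln1 ?muln0.
  under eq_bigr do (under eq_bigr do rewrite mulnDl; rewrite big_split /=).
  rewrite big_split /= [X in (_ + X)%N]exchange_big -big_split.
  apply: eq_bigr => x _ /=.
  by rewrite -!big_distrr -mulnDr -big_split.
by apply: leq_sum => x _; rewrite -[leqRHS]muln1 leq_mul2l matching_degree ?orbT.
Qed.

Lemma leq_sum_divn (I : finType) (P : pred I) (f : I -> nat) d :
  (\sum_(i | P i) f i %/ d <= (\sum_(i | P i) f i) %/ d)%N.
Proof.
elim/big_ind2 : _ => [|a b a' b' ab ab'|//]; first by rewrite div0n.
apply: leq_trans (leq_add ab ab') _; case: d {ab ab'} => [|d]; first by rewrite !divn0.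
by rewrite leq_divRL // mulnDl leq_add ?leq_trunc_div.
Qed.

Lemma sum_cluster_bound (C D : R) (I : finType) (P : pred I) (f : I -> nat) eta :
  (\sum_(i | P i) f i <= eta)%N ->
  \sum_(i | P i) cluster_bound C D (f i) <= cluster_bound C D eta.
Proof.
move=> fe; rewrite /cluster_bound !big_split /= -!mulr_sumr -!natr_sum.
have H d : (\sum_(i | P i) f i %/ d <= eta %/ d)%N.
  by apply: leq_trans (leq_sum_divn _ _ _) _; exact: leq_div2r.
apply: lerD; first apply: lerD; (apply: ler_wpM2l; last by rewrite ler_nat H).
- by rewrite mulr_ge0.
- by rewrite addr_ge0 ?mulr_ge0.
- by rewrite addr_ge0 ?mulr_ge0.
Qed.

Definition hop_gain C D S (m n : mode L) : R :=
  ((m \in S) && (n \notin S))%:R *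
  `|onsite_energy C D (n |: S :\ m) - onsite_energy C D S|.

Lemma bond_species_sum C D S x y : x != y ->
  \sum_s (hop_gain C D S (x, s) (y, s) + hop_gain C D S (y, s) (x, s))
  <= cluster_bound C D (nsite S x + nsite S y).
Proof.
move=> xy; have yx : y != x by rewrite eq_sym.
(* Species present only at [x], only at [y], and at both ends; the last are Pauli-blocked and cannot
   hop along this bond. *)
pose p : nat := nocc (fun s => ((x, s) \in S) && ((y, s) \notin S)).
pose q : nat := nocc (fun s => ((y, s) \in S) && ((x, s) \notin S)).
pose r : nat := nocc (fun s => ((x, s) \in S) && ((y, s) \in S)).
have nx : nsite S x = (p + r)%N.
  rewrite /nsite /nocc -big_split; apply: eq_bigr => s _ /=.
  by case: ((x, s) \in S); case: ((y, s) \in S).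
have ny : nsite S y = (q + r)%N.
  rewrite /nsite /nocc -big_split; apply: eq_bigr => s _ /=.
  by case: ((x, s) \in S); case: ((y, s) \in S).
have pqr : (p + q + r <= 4)%N.
  have -> : 4%N = (\sum_(s : species) 1)%N by rewrite sum1_card card_prod card_bool.
  rewrite /p /q /r /nocc -!big_split; apply: leq_sum => s _ /=.
  by case: ((x, s) \in S); case: ((y, s) \in S).
rewrite nx ny; apply: le_trans (bond_bound C D pqr).
rewrite -nx -ny big_split; apply: lerD.
  rewrite natr_sum mulr_suml; apply: ler_sum => s _; rewrite /hop_gain.
  case: (boolP ((x, s) \in S)) => xS; last by rewrite !mul0r.
  case: (boolP ((y, s) \in S)) => yS; first by rewrite !mul0r.
  by rewrite !mul1r onsite_energy_hop.
rewrite natr_sum mulr_suml; apply: ler_sum => s _; rewrite /hop_gain.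
case: (boolP ((y, s) \in S)) => yS; last by rewrite !mul0r.
case: (boolP ((x, s) \in S)) => xS; first by rewrite !mul0r.
by rewrite !mul1r onsite_energy_hop // addrAC.
Qed.

Lemma Hhop_onsite_bound eta h C D W : 0 <= h -> matching W ->
  sector_bound (numop R (mode L)) eta%:R
    (comm (Hhop h W) (setdiag (onsite_energy C D))) (h * cluster_bound C D eta).
Proof.
move=> h0 hW; rewrite Hhop_dG commDl !commZl.
have -> : comm (numop R (mode L)) (setdiag (onsite_energy C D)) = 0.
  rewrite numop_diag /comm !setdiagM; apply/eqP; rewrite subr_eq0; apply/eqP.
  by congr setdiag; apply/funext => S; rewrite mulrC.
rewrite scaler0 addr0.
have nh : normc (- h)%:C = h by rewrite normcR normrN ger0_norm.
rewrite -[X in sector_bound _ _ _ (X * _)]nh; apply: sector_boundZ.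
apply: hop_diag_bound => [m n|//|m|S Se].
- by rewrite adj_sym.
- rewrite /adj eqxx mul1n; case: (boolP ((m.1, m.1) \in W)) => // mW.
  by have := hW.1 _ mW; rewrite /= eqxx.
under eq_bigr do under eq_bigr do rewrite mulr_natl.
rewrite (adj_sum W (hop_gain C D S)).
apply: (@le_trans _ _ (\sum_(b in W)
   cluster_bound C D (nsite S b.1 + nsite S b.2))).
  by apply: ler_sum => -[x y] bW; apply: bond_species_sum; exact: (hW.1 _ bW).
by apply: sum_cluster_bound; rewrite -Se; exact: sum_bonds_nsite.
Qed.

End Lattice.

(** * Assembly of the seven layers *)

Section Assembly.
Variables (R : realType) (L : nat).
Implicit Types (C D h t : R) (Omega : 'I_6 -> {set site L * site L}).

(** A bond raises one coordinate by 1, so its ends are distinct. *)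
Lemma layering_matching Omega : is_layering Omega -> forall g, matching (Omega g).
Proof.
move=> [cover _ _ Odis] g; split=> [b bg|]; last exact: Odis.
have : b \in bonds L by rewrite -cover; apply/bigcupP; exists g.
rewrite inE => /existsP[d /forallP/(_ d)].
rewrite eqxx addn1 => /eqP bd; apply/eqP => b12.
by move/eqP: bd; rewrite b12 eqn_leq ltnn andbF.
Qed.

Lemma Hfree_layers Omega h : is_layering Omega -> Hfree L h = \sum_g Hhop h (Omega g).
Proof.
move=> [cover disj _ _]; rewrite /Hhop big_split /= -!scaler_sumr; congr (_ *: _ + _).
  have -> : \sum_(b in bonds L) \sum_s hop R b s =
      \sum_g \sum_(b in Omega g) \sum_s hop R b s.
    by rewrite -cover partition_disjoint_bigcup // => g g'; exact: disj.
  by apply: eq_bigr => g _; rewrite exchange_big.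
(* The six on-site terms [h] add up to the coefficient [6 * h]. *)
rewrite sumr_const card_ord [X in _ = _ *: (X *+ _)]exchange_big.
by rewrite -scalerMnr scalerMnl rmorphM rmorph_nat mulr_natl.
Qed.

Lemma Hlayer_sum Omega h C D : is_layering Omega ->
  Heft L h C D = \sum_(g < 7) Hlayer h C D Omega g.
Proof.
move=> hO; rewrite big_ord_recr /= /Heft (Hfree_layers h hO) -addrA; congr (_ + _).
  apply: eq_bigr => g _; rewrite /Hlayer.
  have -> : widen_ord (leqnSn 6) g = lift ord_max g.
    by apply: val_inj; exact: esym (lift_max g).
  by rewrite liftK.
by rewrite /Hlayer unlift_none.
Qed.

Lemma dag_Hhop h (W : {set site L * site L}) : dag (Hhop h W) = Hhop h W.
Proof.
rewrite Hhop_dG dagD !dagZr numop_diag dag_setdiag dag_dG // => m n.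
by rewrite adj_sym.
Qed.

Lemma numop_Hhop h (W : {set site L * site L}) :
  numop R (mode L) *m Hhop h W = Hhop h W *m numop R (mode L).
Proof.
apply/esym/comm_eq0; rewrite Hhop_dG commDl !commZl dG_numop_comm.
by rewrite /comm subrr !scaler0 addr0.
Qed.

Lemma fnorm_le eta (X : fockop R L) c : 0 <= c ->
  sector_bound (numop R (mode L)) eta%:R X c -> fnorm eta X <= c.
Proof.
move=> c0 Xc; rewrite /fnorm; set A := (X in sup X).
(* Without states the supremum takes its default value 0, whence the assumption [0 <= c]. *)
have [->|/classical_sets.set0P A0] := eqVneq A classical_sets.set0.
  by rewrite sup0.
apply: ge_sup => // r [psi [phi [[p1 p2] [q1 q2] ->]]]; rewrite -dagE.
by apply: Xc; split; rewrite ?dagE -?Ntot_numop.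
Qed.

End Assembly.

Theorem theorem27 (R : realType) (L eta : nat) (M aL C D t : R)
    (Omega : 'I_6 -> {set site L * site L})
    (M_gt0 : 0 < M) (aL_gt0 : 0 < aL) (layersP : is_layering Omega) :
  let h := 1 / (2 * M * aL ^+ 2) in
  let A1 := 2 * `|C| in
  let A2 := 2 * `|3 * C + D| + `|D| in
  let A3 := 2 * `|6 * C + 4 * D| + 4 * `|D| in
  fnorm eta (evol t (Heft L h C D) - P1 h C D Omega t)
  <= t ^+ 2 * (15 * h ^+ 2 * eta%:R
               + 6 * h * (A1 * (eta %/ 2)%:R + A2 * (eta %/ 3)%:R
                          + A3 * (eta %/ 4)%:R)).
Proof.
cbv zeta; set h := 1 / _; set A1 := 2 * `|C|; set A2 := _ + `|D|.
set A3 := _ + 4 * `|D|.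
have h0 : 0 <= h by rewrite divr_ge0 // !mulr_ge0 // ltW.
clearbody h; set F := A1 * _ + _ + _.
have FE : F = cluster_bound C D eta by [].
have F0 : 0 <= F by rewrite /F /A1 /A2 /A3 !addr_ge0 ?mulr_ge0 ?addr_ge0 ?mulr_ge0.
clearbody F.
have t0 : 0 <= t ^+ 2 := sqr_ge0 t.
have hh0 : 0 <= h ^+ 2 := sqr_ge0 h.
have hop0 : 0 <= 2 * h ^+ 2 * eta%:R by rewrite !mulr_ge0.
have B0 : 0 <= 15 * h ^+ 2 * eta%:R + 6 * h * F by rewrite addr_ge0 // !mulr_ge0.
apply: fnorm_le; first exact: mulr_ge0.
pose H g := Hlayer h C D Omega g.
pose N := numop R (mode L).
have hop g : H (lift ord_max g) = Hhop h (Omega g) by rewrite /H /Hlayer liftK.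
have diag : H ord_max = setdiag (onsite_energy C D).
  by rewrite /H /Hlayer unlift_none HC_HD_diag.
have Hherm g : dag (H g) = H g.
  case: (unliftP ord_max g) => [k|] ->; first by rewrite hop dag_Hhop.
  by rewrite diag dag_setdiag.
have NH g : N *m H g = H g *m N.
  case: (unliftP ord_max g) => [k|] ->; first by rewrite hop numop_Hhop.
  rewrite diag /N numop_diag !setdiagM; congr setdiag.
  by apply/funext => S; rewrite mulrC.
(* For g < g' the first layer always hops, so the later index alone decides the type of the pair. *)
pose c (g g' : 'I_7) := if (g' < 6)%N then 2 * h ^+ 2 * eta%:R else h * F.
have c0 g g' : 0 <= c g g' by rewrite /c; case: ifP => // _; rewrite mulr_ge0.
have Hc (g g' : 'I_7) : (g < g')%N ->
    sector_bound N eta%:R (comm (H g) (H g')) (c g g').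
  move=> gg'; have gm : g != ord_max.
    apply/eqP => E; move: (ltn_ord g'); rewrite ltnS leqNgt.
    by move: gg'; rewrite E => ->.
  case: (unliftP ord_max g) gm => [k|] -> gm; last by rewrite eqxx in gm.
  rewrite hop /c; case: (unliftP ord_max g') => [k'|] ->.
    rewrite hop lift_max ltn_ord.
    exact: Hhop_comm_bound (layering_matching layersP k) (layering_matching layersP k').
  rewrite diag ltnn FE; apply: Hhop_onsite_bound => //.
  exact: layering_matching layersP k.
have := sector_boundN (trotter_prod t Hherm NH c0 Hc).
rewrite opprB.
have -> : ugroup (\sum_g H g) t = evol t (Heft L h C D).
  by rewrite (Hlayer_sum h C D layersP).
apply: sector_bound_le.
rewrite /c; under eq_bigr do rewrite big_mkcond.
rewrite !big_ord_recl !big_ord0 /=.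
(* Fifteen hopping pairs and six pairs with the interaction, halved. The coefficient 3 obtained for
   [h * F] is then relaxed to the stated 6. *)
rewrite [leLHS](_ : _ = t ^+ 2 * (15 * h ^+ 2 * eta%:R + 3 * h * F)); last by field.
have hF : 0 <= h * F by exact: mulr_ge0.
by rewrite ler_wpM2l // lerD2l -!mulrA ler_wpM2r // ler_nat.
Qed.
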